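(* If $k$ is a $P$-integer, then $k<10^{3500}$.
   Context: Let $k>1$ be an integer and let $\varphi$ denote Euler's totient function. The integer $k$ is called a $P$-integer if the first $\varphi(k)$ primes coprime to $k$ form a reduced residue system modulo $k$. *)

(* Defs.v *)
From mathcomp Require Import all_boot.

Set Implicit Arguments.
Unset Strict Implicit.
Unset Printing Implicit Defensive.

(* The last clause says that no prime coprime to k is skipped. *)
Definition first_coprime_primes (k n : nat) (s : seq nat) : Prop :=
  [/\ sorted ltn s,
      size s = n,
      forall p, p \in s -> prime p /\ coprime p k
    & forall p q, q \in s -> prime p -> coprime p k -> p < q -> p \in s].

(* Pairwise incongruence is injectivity of a |-> a %% k along s (so repeated
   entries are also excluded). *)
Definition reduced_residue_system (k : nat) (s : seq nat) : Prop :=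
  [/\ size s = totient k,
      forall a, a \in s -> coprime a k
    & uniq [seq a %% k | a <- s]].

(* For k > 0 the list s exists and is unique, so the existential merely names
   it. *)
Definition P_integer (k : nat) : Prop :=
  1 < k /\
  exists s : seq nat,
    first_coprime_primes k (totient k) s /\ reduced_residue_system k s.

(* Main.v *)
(** Let k be a P-integer and x = ln k. By Chebyshev's estimate the first phi(k)
    primes coprime to k lie below some N of size about phi(k) x / 0.921, so every
    reduced residue class modulo k contains a prime among its first L = N/k + 1
    terms. For large k this is contradicted by a reduced class a + k Z, a <= k,
    all of whose first L terms are composite (Pomerance's use of the Jacobsthal
    function). To find a, choose for the primes p <= z not dividing k residues
    that greedily eliminate as many indices i < L as possible; at most
    L prod_(p <= z, p not dividing k) (1 - 1/p) indices survive. The factor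
    phi(k)/k in L supplies the primes dividing k, so this is about
    x prod_(p <= z) (1 - 1/p) / 0.921. Kill each survivor with one further prime
    in (z, Q] not dividing k. The modulus used is at most
    exp(theta(z) + (number of survivors) ln Q), and it is smaller than k because
    prod_(p <= z) (1 - 1/p) is about e^(-gamma) / ln z, by Mertens. Taking
    a = 1 modulo the primes p <= z dividing k costs nothing in this bound, and the
    prime divisors of k above z are avoided by a union bound.

    For x < 400000 the parameter z is one of 1000, 2000, 4000, 8000 and the sums
    over primes up to z are computed; beyond that z = x/16 and Mertens' estimate
    is started at 8000. *)

From Stdlib Require Import Reals Lra Lia NArith ZArith.
From Coquelicot Require Import Coquelicot.
From HB Require Import structures.
From mathcomp Require Import all_boot.
Require Import Defs.

Set Implicit Arguments.
Unset Strict Implicit.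
Unset Printing Implicit Defensive.

Delimit Scope R_scope with R.
Local Open Scope nat_scope.

(** * Sums over primes and logarithms *)

HB.instance Definition _ := Monoid.isComLaw.Build R 0%R Rplus
  (fun x y z => esym (Rplus_assoc x y z)) Rplus_comm Rplus_0_l.
HB.instance Definition _ := Monoid.isComLaw.Build R 1%R Rmult
  (fun x y z => esym (Rmult_assoc x y z)) Rmult_comm Rmult_1_l.

Notation "\rsum_ ( i <- r ) F" := (\big[Rplus/0%R]_(i <- r) F%R)
  (at level 41, F at level 41, i, r at level 50).
Notation "\rprod_ ( i <- r ) F" := (\big[Rmult/1%R]_(i <- r) F%R)
  (at level 36, F at level 36, i, r at level 50).

Definition primes_upto (n : nat) : seq nat := [seq p <- iota 0 n.+1 | prime p].
Arguments primes_upto : simpl never.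

Lemma mem_primes_upto n p : (p \in primes_upto n) = prime p && (p <= n).
Proof. by rewrite mem_filter mem_iota add0n ltnS. Qed.

Lemma primes_upto_uniq n : uniq (primes_upto n).
Proof. by rewrite filter_uniq // iota_uniq. Qed.

Lemma primes_upto_S n : primes_upto n.+1 = primes_upto n ++ (if prime n.+1 then [:: n.+1] else [::]).
Proof. by rewrite /primes_upto -(addn1 n.+1) iotaD filter_cat. Qed.

Lemma primes_upto_prime n p : p \in primes_upto n -> prime p.
Proof. by rewrite mem_primes_upto => /andP[]. Qed.

Lemma primes_upto_le n p : p \in primes_upto n -> p <= n.
Proof. by rewrite mem_primes_upto => /andP[]. Qed.

Lemma leINR m n : m <= n -> (INR m <= INR n)%R.
Proof. by move=> h; apply: le_INR; apply/leP. Qed.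

Lemma ltINR m n : m < n -> (INR m < INR n)%R.
Proof. by move=> h; apply: lt_INR; apply/ltP. Qed.

Lemma INR_leq m n : (INR m <= INR n)%R -> m <= n.
Proof. by move=> h; apply/leP; apply: INR_le. Qed.

Lemma INR_ltn m n : (INR m < INR n)%R -> m < n.
Proof. by move=> h; apply/ltP; apply: INR_lt. Qed.

Lemma INR_gt0 n : 0 < n -> (0 < INR n)%R.
Proof. by move=> h; have := ltINR h. Qed.

Lemma INR_prime_ge2 p : prime p -> (2 <= INR p)%R.
Proof. by move=> /prime_gt1 h; have := leINR h; rewrite /=; lra. Qed.

Lemma INRM m n : INR (m * n) = (INR m * INR n)%R.
Proof. exact: mult_INR. Qed.

Lemma INRD m n : INR (m + n) = (INR m + INR n)%R.
Proof. exact: plus_INR. Qed.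

Lemma INR_pred_prime p : prime p -> INR p.-1 = (INR p - 1)%R.
Proof. by move=> /prime_gt0; case: p => // p _; rewrite S_INR /=; lra. Qed.

Lemma INR_expn m n : INR (m ^ n) = (INR m ^ n)%R.
Proof. by elim: n => [|n IH] //=; rewrite expnS INRM IH. Qed.

Lemma rsum_le (s : seq nat) (f g : nat -> R) :
  (forall i, i \in s -> (f i <= g i)%R) -> (\rsum_(i <- s) f i <= \rsum_(i <- s) g i)%R.
Proof.
elim: s => [|a s IH] h; first by rewrite !big_nil; lra.
rewrite !big_cons; apply: Rplus_le_compat; first by apply: h; rewrite inE eqxx.
by apply: IH => i hi; apply: h; rewrite inE hi orbT.
Qed.

Lemma rsum_scale (s : seq nat) (c : R) (f : nat -> R) :
  (\rsum_(i <- s) (c * f i) = c * \rsum_(i <- s) f i)%R.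
Proof.
elim: s => [|a s IH]; first by rewrite !big_nil; lra.
by rewrite !big_cons IH; lra.
Qed.

Lemma rsum_const (s : seq nat) (c : R) : (\rsum_(i <- s) c = INR (size s) * c)%R.
Proof.
elim: s => [|a s IH]; first by rewrite big_nil /=; lra.
by rewrite big_cons IH (_ : size (a :: s) = (size s).+1) // S_INR; lra.
Qed.

Lemma rsum_ge0 (s : seq nat) (f : nat -> R) :
  (forall i, i \in s -> (0 <= f i)%R) -> (0 <= \rsum_(i <- s) f i)%R.
Proof.
move=> h; have := rsum_le (f := fun _ => 0%R) h.
by rewrite rsum_const; lra.
Qed.

Lemma rsum_subseq (s t : seq nat) (f : nat -> R) :
  uniq s -> uniq t -> {subset s <= t} -> (forall i, i \in t -> (0 <= f i)%R) ->
  (\rsum_(i <- s) f i <= \rsum_(i <- t) f i)%R.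
Proof.
move=> us ut st h.
rewrite [X in (_ <= X)%R](bigID (fun i => i \in s)) /=.
have -> : (\big[Rplus/0%R]_(i <- t | i \in s) f i = \rsum_(i <- s) f i)%R.
  rewrite -big_filter; apply: perm_big; apply: uniq_perm => //.
    by rewrite filter_uniq.
  by move=> i; rewrite mem_filter; case hi: (i \in s) => //=; rewrite (st _ hi).
rewrite -[X in (X <= _)%R]Rplus_0_r; apply: Rplus_le_compat_l.
by rewrite -big_filter; apply: rsum_ge0 => i; rewrite mem_filter => /andP[_ /h].
Qed.

Lemma rprod_gt0 (s : seq nat) (f : nat -> R) :
  (forall i, i \in s -> (0 < f i)%R) -> (0 < \rprod_(i <- s) f i)%R.
Proof.
elim: s => [|a s IH] h; first by rewrite big_nil; lra.
rewrite big_cons; apply: Rmult_lt_0_compat; first by apply: h; rewrite inE eqxx.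
by apply: IH => i hi; apply: h; rewrite inE hi orbT.
Qed.

Lemma rprod_le (s : seq nat) (f g : nat -> R) :
  (forall i, i \in s -> (0 <= f i <= g i)%R) ->
  (0 <= \rprod_(i <- s) f i <= \rprod_(i <- s) g i)%R.
Proof.
elim: s => [|a s IH] h; first by rewrite !big_nil; lra.
have ha : (0 <= f a <= g a)%R by apply: h; rewrite inE eqxx.
have hs : (0 <= \rprod_(i <- s) f i <= \rprod_(i <- s) g i)%R.
  by apply: IH => i hi; apply: h; rewrite inE hi orbT.
rewrite !big_cons; split; first by apply: Rmult_le_pos; lra.
by apply: Rmult_le_compat; lra.
Qed.

Lemma INR_prod (s : seq nat) (f : nat -> nat) :
  INR (\prod_(i <- s) f i) = \rprod_(i <- s) INR (f i).
Proof.
elim: s => [|a s IH]; first by rewrite !big_nil.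
by rewrite !big_cons INRM IH.
Qed.

Lemma ln_rprod (s : seq nat) (f : nat -> R) :
  (forall i, i \in s -> (0 < f i)%R) ->
  ln (\rprod_(i <- s) f i) = \rsum_(i <- s) ln (f i).
Proof.
elim: s => [|a s IH] h; first by rewrite !big_nil ln_1.
have hs i : i \in s -> (0 < f i)%R by move=> hi; apply: h; rewrite inE hi orbT.
rewrite !big_cons ln_mult ?IH //; first by apply: h; rewrite inE eqxx.
exact: rprod_gt0.
Qed.

(** * Elementary and numerical bounds for the logarithm *)

Lemma ln_le_sub1 (x : R) : (0 < x)%R -> (ln x <= x - 1)%R.
Proof. by move=> x0; have := exp_ineq1_le (ln x); rewrite exp_ln //; lra. Qed.

Lemma ln_tangent (c x : R) : (0 < c)%R -> (0 < x)%R -> (ln x <= ln c + (x / c - 1))%R.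
Proof.
move=> c0 x0; have h : (0 < x / c)%R by apply: Rdiv_lt_0_compat.
have -> : ln x = (ln c + ln (x / c))%R.
  by rewrite -ln_mult //; congr ln; field; lra.
by have := ln_le_sub1 h; lra.
Qed.

Lemma ge0_of_derive (f df : R -> R) (u : R) : (0 <= u)%R ->
  (forall t, (0 <= t <= u)%R -> is_derive f t (df t)) ->
  (forall t, (0 <= t <= u)%R -> (0 <= df t)%R) -> (f 0 <= f u)%R.
Proof.
move=> u0 hd hp.
have [||c [hc e]] := MVT_gen f 0 u df.
- by move=> t; rewrite Rmin_left ?Rmax_right // => ht; apply: hd; lra.
- move=> t; rewrite Rmin_left ?Rmax_right // => ht.
  by apply: derivable_continuous_pt; exists (df t); apply/is_derive_Reals; apply: hd; lra.
move: hc; rewrite Rmin_left ?Rmax_right // => hc.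
by have := Rmult_le_pos _ _ (hp c hc) u0; lra.
Qed.

(** The difference vanishes at 0 and its derivative is the nonnegative rational function given to
    [ge0_of_derive]. This bound and the upper one in [ln1p_le] both agree with [ln (1 + u)] to
    second order, so they are sharp for small u. *)
Lemma ln1p_ge (u : R) : (0 <= u)%R -> (2 * u / (2 + u) <= ln (1 + u))%R.
Proof.
move=> u0.
suff : (ln (1 + 0) - 2 * 0 / (2 + 0) <= ln (1 + u) - 2 * u / (2 + u))%R.
  by rewrite !Rplus_0_r ln_1; lra.
apply: (@ge0_of_derive (fun t => ln (1 + t) - 2 * t / (2 + t))%R
  (fun t => t ^ 2 / ((1 + t) * (2 + t) ^ 2))%R) => // t ht.
  by auto_derive; [lra | field; lra].
apply: Rle_mult_inv_pos; first exact: pow2_ge_0.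
by apply: Rmult_lt_0_compat; [lra | apply: pow_lt; lra].
Qed.

Lemma ln1p_le (u : R) : (0 <= u)%R -> (ln (1 + u) <= u * (2 + u) / (2 * (1 + u)))%R.
Proof.
move=> u0.
suff : (0 * (2 + 0) / (2 * (1 + 0)) - ln (1 + 0) <= u * (2 + u) / (2 * (1 + u)) - ln (1 + u))%R.
  by rewrite !Rplus_0_r ln_1; lra.
apply: (@ge0_of_derive (fun t => t * (2 + t) / (2 * (1 + t)) - ln (1 + t))%R
  (fun t => t ^ 2 / (2 * (1 + t) ^ 2))%R) => // t ht.
  by auto_derive; [lra | field; lra].
apply: Rle_mult_inv_pos; first exact: pow2_ge_0.
by apply: Rmult_lt_0_compat; [lra | apply: pow_lt; lra].
Qed.

(* 2, 3 and 5 are products of powers of 16/15, 25/24 and 81/80, whose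
   logarithms are given very accurately by [ln1p_ge] and [ln1p_le]. *)
Lemma ln_16_15 : (0.064516 <= ln (16 / 15) <= 0.064584)%R.
Proof.
have -> : (16 / 15 = 1 + 1 / 15)%R by field.
have h : (0 <= 1 / 15)%R by lra.
by have := ln1p_ge h; have := ln1p_le h; lra.
Qed.

Lemma ln_25_24 : (0.040816 <= ln (25 / 24) <= 0.040834)%R.
Proof.
have -> : (25 / 24 = 1 + 1 / 24)%R by field.
have h : (0 <= 1 / 24)%R by lra.
by have := ln1p_ge h; have := ln1p_le h; lra.
Qed.

Lemma ln_81_80 : (0.012422 <= ln (81 / 80) <= 0.012424)%R.
Proof.
have -> : (81 / 80 = 1 + 1 / 80)%R by field.
have h : (0 <= 1 / 80)%R by lra.
by have := ln1p_ge h; have := ln1p_le h; lra.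
Qed.

Lemma ln_235_ratios :
  [/\ ln (16 / 15) = 4 * ln 2 - ln 3 - ln 5,
      ln (25 / 24) = 2 * ln 5 - 3 * ln 2 - ln 3
    & ln (81 / 80) = 4 * ln 3 - 4 * ln 2 - ln 5]%R.
Proof.
have l4 : (ln 4 = 2 * ln 2)%R by have := @ln_mult 2 2 ltac:(lra) ltac:(lra); rewrite (_ : 2 * 2 = 4)%R; lra.
have l16 : (ln 16 = 4 * ln 2)%R by have := @ln_mult 4 4 ltac:(lra) ltac:(lra); rewrite (_ : 4 * 4 = 16)%R; lra.
have l15 : (ln 15 = ln 3 + ln 5)%R by have := @ln_mult 3 5 ltac:(lra) ltac:(lra); rewrite (_ : 3 * 5 = 15)%R; lra.
have l25 : (ln 25 = 2 * ln 5)%R by have := @ln_mult 5 5 ltac:(lra) ltac:(lra); rewrite (_ : 5 * 5 = 25)%R; lra.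
have l8 : (ln 8 = 3 * ln 2)%R by have := @ln_mult 4 2 ltac:(lra) ltac:(lra); rewrite (_ : 4 * 2 = 8)%R; lra.
have l24 : (ln 24 = 3 * ln 2 + ln 3)%R by have := @ln_mult 8 3 ltac:(lra) ltac:(lra); rewrite (_ : 8 * 3 = 24)%R; lra.
have l9 : (ln 9 = 2 * ln 3)%R by have := @ln_mult 3 3 ltac:(lra) ltac:(lra); rewrite (_ : 3 * 3 = 9)%R; lra.
have l81 : (ln 81 = 4 * ln 3)%R by have := @ln_mult 9 9 ltac:(lra) ltac:(lra); rewrite (_ : 9 * 9 = 81)%R; lra.
have l80 : (ln 80 = 4 * ln 2 + ln 5)%R by have := @ln_mult 16 5 ltac:(lra) ltac:(lra); rewrite (_ : 16 * 5 = 80)%R; lra.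
by split; rewrite ln_div; lra.
Qed.

Lemma ln2_bounds : (0.69295 <= ln 2 <= 0.69354)%R.
Proof.
case: ln_235_ratios => e1 e2 e3.
by have := ln_16_15; have := ln_25_24; have := ln_81_80; lra.
Qed.

Lemma ln3_bounds : (1.0983 <= ln 3 <= 1.0993)%R.
Proof.
case: ln_235_ratios => e1 e2 e3.
by have := ln_16_15; have := ln_25_24; have := ln_81_80; lra.
Qed.

Lemma ln5_bounds : (1.6090 <= ln 5 <= 1.6104)%R.
Proof.
case: ln_235_ratios => e1 e2 e3.
by have := ln_16_15; have := ln_25_24; have := ln_81_80; lra.
Qed.

Lemma exp_le_mono (x y : R) : (x <= y)%R -> (exp x <= exp y)%R.
Proof. by case=> [h|->]; [apply/Rlt_le/exp_increasing | lra]. Qed.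

Lemma rsum_primes_upto_prime (f : nat -> R) n : prime n.+1 ->
  \rsum_(p <- primes_upto n.+1) f p = (\rsum_(p <- primes_upto n) f p + f n.+1)%R.
Proof. by move=> pr; rewrite primes_upto_S pr big_cat big_seq1. Qed.

Lemma rprod_primes_upto_prime (f : nat -> R) n : prime n.+1 ->
  \rprod_(p <- primes_upto n.+1) f p = (\rprod_(p <- primes_upto n) f p * f n.+1)%R.
Proof. by move=> pr; rewrite primes_upto_S pr big_cat big_seq1. Qed.

(** * Chebyshev bounds *)

Lemma prod_primes m : 0 < m -> m = \prod_(p <- primes m) p ^ logn p m.
Proof. by move=> m0; rewrite [LHS]prod_prime_decomp // prime_decompE big_map. Qed.

Lemma ln_INR_exp p n : 0 < p -> ln (INR (p ^ n)) = (INR n * ln (INR p))%R.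
Proof. by move=> p0; rewrite INR_expn ln_pow //; apply: INR_gt0. Qed.

(** The bound B is free so that the logarithms of several factorials can be compared prime by prime
    over one common list; primes not dividing m enter with multiplicity 0. *)
Lemma ln_prime_powers B m : 0 < m -> (forall p, prime p -> p %| m -> p <= B) ->
  ln (INR m) = \rsum_(p <- primes_upto B) (INR (logn p m) * ln (INR p)).
Proof.
move=> m0 hB.
rewrite (bigID (fun p => p \in primes m)) /=.
rewrite [X in (_ = _ + X)%R]big1_seq => [|p /andP[hp _]]; last first.
  by rewrite lognE -mem_primes (negbTE hp) /=; lra.
rewrite Rplus_0_r -big_filter.
have -> : ln (INR m) = \rsum_(p <- primes m) (INR (logn p m) * ln (INR p)).
  have pg p : p \in primes m -> 0 < p by rewrite mem_primes => /and3P[/prime_gt0].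
  rewrite {1}(prod_primes m0) INR_prod ln_rprod => [|p hp].
    by apply: eq_big_seq => p hp; rewrite ln_INR_exp // pg.
  by apply: INR_gt0; rewrite expn_gt0 pg.
apply: perm_big; apply: uniq_perm; [exact: primes_uniq | exact: (filter_uniq _ (primes_upto_uniq B)) |].
move=> p; rewrite mem_filter mem_primes_upto; case hp: (p \in primes m) => //=.
by move: hp; rewrite mem_primes => /and3P[pp _ pm]; rewrite pp hB.
Qed.

Lemma prime_dvd_fact_le n p : prime p -> p %| n`! -> p <= n.
Proof.
move=> pp; elim: n => [|n IH]; first by rewrite fact0 Euclid_dvd1.
rewrite factS Euclid_dvdM // => /orP[/dvdn_leq->//|/IH h].
exact: leq_trans h _.
Qed.

Lemma ln_fact_primes B n : n <= B ->
  ln (INR n`!) = \rsum_(p <- primes_upto B) (INR (logn p n`!) * ln (INR p)).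
Proof.
move=> nB; apply: ln_prime_powers; first exact: fact_gt0.
by move=> p pp /(prime_dvd_fact_le pp) h; apply: leq_trans nB.
Qed.

Lemma ln_factS n : ln (INR n.+1`!) = (ln (INR n.+1) + ln (INR n`!))%R.
Proof. by rewrite factS INRM ln_mult //; apply: INR_gt0; rewrite ?fact_gt0. Qed.

(** Weak Stirling bound. The induction step is (n + 1) (ln (n + 2) - ln (n + 1)) <= 1, a tangent
    inequality. *)
Lemma ln_fact_ge n : (INR n * ln (INR n.+1) - INR n <= ln (INR n`!))%R.
Proof.
elim: n => [|n IH]; first by rewrite fact0 ln_1 /=; lra.
rewrite ln_factS.
have n0 : (0 < INR n.+1)%R by apply: INR_gt0.
have n1 : (0 < INR n.+2)%R by apply: INR_gt0.
have e2 : INR n.+2 = (INR n.+1 + 1)%R by rewrite S_INR.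
have e1 : INR n.+1 = (INR n + 1)%R by rewrite S_INR.
have := ln_tangent n0 n1.
have -> : (INR n.+2 / INR n.+1 - 1 = / INR n.+1)%R by rewrite e2; field; lra.
move=> h; have := Rmult_le_compat_l _ _ _ (Rlt_le _ _ n0) h.
rewrite Rmult_plus_distr_l Rinv_r; last by lra.
by move=> {}h; nra.
Qed.

Lemma ln_fact_le n : 0 < n ->
  (ln (INR n`!) <= (INR n + 1) * ln (INR n) - INR n + 1)%R.
Proof.
elim: n => [//|n IH] _; case: (posnP n) => [->|n0]; first by rewrite factS fact0 muln1 /= ln_1; lra.
move/(_ n0): IH; rewrite ln_factS => IH.
have p0 : (0 < INR n)%R by apply: INR_gt0.
have p1 : (0 < INR n.+1)%R by apply: INR_gt0.
have e1 : INR n.+1 = (INR n + 1)%R by rewrite S_INR.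
have := ln_tangent p1 p0.
have -> : (INR n / INR n.+1 - 1 = - / INR n.+1)%R by rewrite e1; field; lra.
move=> h; have := Rmult_le_compat_l _ _ _ (Rlt_le _ _ p1) h.
rewrite Rmult_plus_distr_l Ropp_mult_distr_r_reverse Rinv_r; last by lra.
by move=> {}h; nra.
Qed.

(** In Legendre's formula the terms with p^i > n vanish, so factorials of different sizes can share
    one range of exponents. *)
Lemma logn_fact_widen p n B : prime p -> n <= B ->
  logn p n`! = \sum_(1 <= i < B.+1) n %/ p ^ i.
Proof.
move=> pp nB; rewrite logn_fact // [RHS](big_cat_nat (n := n.+1)) //=.
suff -> : \sum_(n.+1 <= i < B.+1) n %/ p ^ i = 0 by rewrite addn0.
rewrite big_nat_cond big1 // => i /andP[/andP[hi _] _].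
apply: divn_small; apply: leq_trans hi _.
by apply: ltnW; apply: ltn_expl; apply: prime_gt1.
Qed.

(** With x = 30 j / q this is Chebyshev's inequality [x] + [x/30] <= [x/2] + [x/3] + [x/5] + 1 for x
    >= 1. Since 30 + 1 = 15 + 10 + 6, the quotient of j by q cancels and only x < 30 remains. *)
Lemma chebyshev_floor j q : 0 < q ->
  30 * j %/ q + j %/ q <=
  15 * j %/ q + 10 * j %/ q + 6 * j %/ q + (q <= 30 * j).
Proof.
move=> q0; case: (leqP q (30 * j)) => [_|h]; last first.
  by rewrite (divn_small h) (divn_small (leq_ltn_trans _ h)) ?leq_pmull.
rewrite {1 2 3 4 5}(divn_eq j q).
have hd a : a * (j %/ q * q + j %% q) %/ q = a * (j %/ q) + a * (j %% q) %/ q.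
  by rewrite mulnDr mulnA divnMDl.
have rq : j %% q < q by rewrite ltn_mod.
rewrite !hd divnMDl // (divn_small rq).
set u := 30 * (j %% q) %/ q.
have u30 : u < 30 by rewrite /u ltn_divLR // ltn_pmul2l.
have e2 : 15 * (j %% q) %/ q = u %/ 2.
  by rewrite /u -divnMA [q * 2]mulnC -[30]/(2 * 15) -mulnA divnMl.
have e3 : 10 * (j %% q) %/ q = u %/ 3.
  by rewrite /u -divnMA [q * 3]mulnC -[30]/(3 * 10) -mulnA divnMl.
have e5 : 6 * (j %% q) %/ q = u %/ 5.
  by rewrite /u -divnMA [q * 5]mulnC -[30]/(5 * 6) -mulnA divnMl.
rewrite e2 e3 e5.
(* All floors depend only on the integer part u < 30 of x, which leaves 30 cases to evaluate. *)
have : u <= u %/ 2 + u %/ 3 + u %/ 5 + 1.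
  by move: u30; clear; do 30 (case: u => [//|u]).
move: (j %/ q) (u %/ 2) (u %/ 3) (u %/ 5) => a b c d /leP h; apply/leP; move: h.
rewrite -!plusE -!multE /=; lia.
Qed.

(** The bound by B is carried along for the induction: if p^(B+1) <= n, the earlier count is at most
    B, which is below [trunc_log p n]. *)
Lemma sum_prime_powers_le p n B : prime p -> 0 < n ->
  \sum_(1 <= i < B.+1) (p ^ i <= n) <= minn B (trunc_log p n).
Proof.
move=> pp n0; elim: B => [|B IH]; first by rewrite big_geq.
rewrite big_nat_recr //=; case: (leqP (p ^ B.+1) n) => h; last first.
  by rewrite addn0; apply: leq_trans IH _; rewrite leq_min !geq_min leqnSn leqnn orbT.
have hB := leq_trans IH (geq_minl _ _).
by rewrite addn1 leq_min ltnS hB (leq_ltn_trans hB (trunc_log_max (prime_gt1 pp) h)).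
Qed.

Lemma chebyshev_logn p j : prime p -> 0 < j ->
  logn p (30 * j)`! + logn p j`! <=
  logn p (15 * j)`! + logn p (10 * j)`! + logn p (6 * j)`! + trunc_log p (30 * j).
Proof.
move=> pp j0.
have j30 : 0 < 30 * j by rewrite muln_gt0.
rewrite (@logn_fact_widen p (30 * j) (30 * j)) // (@logn_fact_widen p j (30 * j)) ?leq_pmull //.
rewrite (@logn_fact_widen p (15 * j) (30 * j)) ?leq_mul2r ?orbT //.
rewrite (@logn_fact_widen p (10 * j) (30 * j)) ?leq_mul2r ?orbT //.
rewrite (@logn_fact_widen p (6 * j) (30 * j)) ?leq_mul2r ?orbT //.
have := sum_prime_powers_le (30 * j) pp j30; rewrite minnC => h.
apply: (leq_trans _ (leq_add (leqnn _) (leq_trans h (geq_minl _ _)))).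
rewrite -!big_split /=; apply: leq_sum => i _.
by apply: chebyshev_floor; rewrite expn_gt0 prime_gt0.
Qed.

Lemma ln_ge0 n : 0 < n -> (0 <= ln (INR n))%R.
Proof.
move=> n0; rewrite -ln_1; apply: ln_le; first by lra.
by have := leINR n0.
Qed.

Lemma trunc_log_ln p n : prime p -> 0 < n ->
  (INR (trunc_log p n) * ln (INR p) <= ln (INR n))%R.
Proof.
move=> pp n0; rewrite -ln_INR_exp ?prime_gt0 //; apply: ln_le.
  by apply: INR_gt0; rewrite expn_gt0 prime_gt0.
by apply: leINR; apply: trunc_logP => //; apply: prime_gt1.
Qed.

(** Each prime p <= 30 j has an excess of at most [trunc_log p (30 * j)] factors, worth at most ln
    (30 j); the excess is therefore paid by the number of primes up to 30 j. *)
Lemma chebyshev_ln_fact j : 0 < j ->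
  (ln (INR (30 * j)`!) + ln (INR j`!) <=
   ln (INR (15 * j)`!) + ln (INR (10 * j)`!) + ln (INR (6 * j)`!)
   + INR (size (primes_upto (30 * j))) * ln (INR (30 * j)))%R.
Proof.
move=> j0.
have j30 : 0 < 30 * j by rewrite muln_gt0.
rewrite (@ln_fact_primes (30 * j) (30 * j)) // (@ln_fact_primes (30 * j) j) ?leq_pmull //.
rewrite (@ln_fact_primes (30 * j) (15 * j)) ?leq_mul2r ?orbT //.
rewrite (@ln_fact_primes (30 * j) (10 * j)) ?leq_mul2r ?orbT //.
rewrite (@ln_fact_primes (30 * j) (6 * j)) ?leq_mul2r ?orbT //.
set L := ln (INR (30 * j)).
rewrite -rsum_const -!big_split /=; apply: rsum_le => p /primes_upto_prime pp.
have lp : (0 <= ln (INR p))%R by apply: ln_ge0; apply: prime_gt0.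
have := leINR (chebyshev_logn pp j0); rewrite !INRD => h.
have := Rmult_le_compat_r _ _ _ lp h.
by have := trunc_log_ln pp j30; rewrite -/L; lra.
Qed.

(** Stirling's bounds turn Chebyshev's combination into j (14 ln 2 + 9 ln 3 + 5 ln 5), and the
    bracket just exceeds 30 * 0.921. The summand 3 absorbs the three logarithmic error terms of the
    upper bounds for factorials. *)
Lemma pi_lower j : 0 < j ->
  (0.921 * INR (30 * j) <= (INR (size (primes_upto (30 * j))) + 3) * ln (INR (30 * j)))%R.
Proof.
move=> j0; have := chebyshev_ln_fact j0.
have x0 : (0 < INR j)%R by apply: INR_gt0.
have x1 : (1 <= INR j)%R by have := leINR j0.
have lb n : (INR n * ln (INR n.+1) - INR n <= ln (INR n`!))%R by exact: ln_fact_ge.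
have lnS n : 0 < n -> (ln (INR n) <= ln (INR n.+1))%R.
  by move=> n0; apply: ln_le; [apply: INR_gt0 | apply: leINR].
have l30 := lb (30 * j); have l1 := lb j.
have s30 := lnS (30 * j) ltac:(by rewrite muln_gt0); have s1 := lnS j j0.
have u15 := @ln_fact_le (15 * j) ltac:(by rewrite muln_gt0).
have u10 := @ln_fact_le (10 * j) ltac:(by rewrite muln_gt0).
have u6 := @ln_fact_le (6 * j) ltac:(by rewrite muln_gt0).
have i30 : INR (30 * j) = (30 * INR j)%R by rewrite INRM /=; lra.
have i15 : INR (15 * j) = (15 * INR j)%R by rewrite INRM /=; lra.
have i10 : INR (10 * j) = (10 * INR j)%R by rewrite INRM /=; lra.
have i6 : INR (6 * j) = (6 * INR j)%R by rewrite INRM /=; lra.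
have m6 : (ln 6 = ln 2 + ln 3)%R by rewrite -ln_mult; [congr ln | |]; lra.
have m10 : (ln 10 = ln 2 + ln 5)%R by rewrite -ln_mult; [congr ln | |]; lra.
have m15 : (ln 15 = ln 3 + ln 5)%R by rewrite -ln_mult; [congr ln | |]; lra.
have m30 : (ln 30 = ln 2 + ln 15)%R by rewrite -ln_mult; [congr ln | |]; lra.
have e30 : (ln (INR (30 * j)) = ln 30 + ln (INR j))%R by rewrite i30 ln_mult; lra.
have e15 : (ln (INR (15 * j)) = ln 15 + ln (INR j))%R by rewrite i15 ln_mult; lra.
have e10 : (ln (INR (10 * j)) = ln 10 + ln (INR j))%R by rewrite i10 ln_mult; lra.
have e6 : (ln (INR (6 * j)) = ln 6 + ln (INR j))%R by rewrite i6 ln_mult; lra.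
rewrite i30 in l30.
rewrite e15 m15 i15 in u15; rewrite e10 m10 i10 in u10; rewrite e6 m6 i6 in u6.
have l30' := Rmult_le_compat_l (30 * INR j) _ _ ltac:(lra) s30.
have l1' := Rmult_le_compat_l (INR j) _ _ ltac:(lra) s1.
rewrite e30 m30 m15 in l30' *; rewrite i30 {i30 i15 i10 i6 e30 e15 e10 e6 m6 m10 m15 m30 s30 s1 lb lnS}.
have [h2 _] := ln2_bounds; have [h3 _] := ln3_bounds; have [h5 _] := ln5_bounds.
set X := INR j in x0 x1 l30 l1 u15 u10 u6 l30' l1' *; set Y := ln X in u15 u10 u6 l30' l1' *.
have q2 := Rmult_le_compat_l X _ _ (Rlt_le _ _ x0) h2.
have q3 := Rmult_le_compat_l X _ _ (Rlt_le _ _ x0) h3.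
have q5 := Rmult_le_compat_l X _ _ (Rlt_le _ _ x0) h5.
move=> h; nra.
Qed.

(** * Mertens' product *)

Lemma prod_primes_dvd (s : seq nat) m : uniq s ->
  (forall p, p \in s -> prime p) -> (forall p, p \in s -> p %| m) -> \prod_(p <- s) p %| m.
Proof.
elim: s => [|a s IH]; first by rewrite big_nil.
move=> /= /andP[as_ us] hp hd; rewrite big_cons Gauss_dvd.
  rewrite hd ?inE ?eqxx //= IH // => p ps; [apply: hp | apply: hd]; by rewrite inE ps orbT.
rewrite prime_coprime ?hp ?inE ?eqxx //.
rewrite Euclid_dvd_prod ?hp ?inE ?eqxx //.
apply/negP; rewrite big_has => /hasP[q qs].
rewrite dvdn_prime2 ?hp ?inE ?eqxx ?qs ?orbT // => /eqP e.
by rewrite e qs in as_.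
Qed.

Lemma primes_upto_split m n : m <= n -> primes_upto n = primes_upto m ++ [seq p <- primes_upto n | m < p].
Proof.
elim: n => [|n IH]; first by rewrite leqn0 => /eqP->.
rewrite leq_eqVlt => /orP[/eqP->|].
  rewrite -[LHS]cats0; congr (_ ++ _); apply/esym/eqP; rewrite -size_eq0 size_filter.
  rewrite -leqn0 leqNgt -has_count; apply/hasPn => p /primes_upto_le; by rewrite -leqNgt.
rewrite ltnS => mn; rewrite primes_upto_S {1}(IH mn) filter_cat catA; congr (_ ++ _).
by case: ifP => // _ /=; rewrite ltnS mn.
Qed.

Lemma prime_dvd_bin n m p : prime p -> p <= n -> m < p -> n - m < p -> m <= n -> p %| 'C(n, m).
Proof.
move=> pp pn mp nmp mn; have : p %| n`! by apply: dvdn_fact; rewrite prime_gt0.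
rewrite -(bin_fact mn) !Euclid_dvdM // => /orP[//|/orP[]] /(prime_dvd_fact_le pp);
  by rewrite leqNgt ?mp ?nmp.
Qed.

(** This coefficient occurs twice in row 2m + 1, whose sum is 2 * 4^m. *)
Lemma bin_odd_le m : 'C(m.*2.+1, m) <= 4 ^ m.
Proof.
have h : 2 * 'C(m.*2.+1, m) <= 2 * 4 ^ m.
  have -> : 2 * 4 ^ m = \sum_(i < m.*2.+2) 'C(m.*2.+1, i).
    have := expnDn 1 1 m.*2.+1; rewrite addn1 => e.
    rewrite -[4]/(2 ^ 2) -expnM -expnS mul2n e; apply: eq_bigr => i _.
    by rewrite !exp1n !muln1.
  have l1 : m < m.*2.+2 by rewrite -addnn !ltnS leqW // leq_addr.
  have l2 : m.+1 < m.*2.+2 by rewrite -addnn !ltnS leq_addr.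
  rewrite (bigD1 (Ordinal l1)) //= (bigD1 (Ordinal l2)) /=; last first.
    by rewrite -val_eqE /= eqn_leq ltnn.
  have -> : 'C(m.*2.+1, m.+1) = 'C(m.*2.+1, m).
    by rewrite -addnn -bin_sub ?ltnS ?leq_addr // subSS addnK.
  by rewrite mul2n -addnn addnA leq_addr.
by rewrite leq_pmul2l in h.
Qed.

(** Erdős's argument: for n = 2m + 1 the primes in (m + 1, 2m + 1] divide the binomial coefficient
    C(2m + 1, m), which is at most 4^m, and the primes up to m + 1 are covered by induction. An even
    n > 2 adds no prime. *)
Lemma primorial_le n : \prod_(p <- primes_upto n) p <= 4 ^ n.
Proof.
elim/ltn_ind: n => n IH.
case: n IH => [|[|[|n]]] IH.
- by rewrite (_ : primes_upto 0 = [::]) // big_nil.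
- by rewrite (_ : primes_upto 1 = [::]) // big_nil.
- by rewrite (_ : primes_upto 2 = [:: 2]) // big_seq1.
have prodS k : ~~ prime k.+1 -> \prod_(p <- primes_upto k.+1) p = \prod_(p <- primes_upto k) p.
  by move=> h; rewrite primes_upto_S (negbTE h) cats0.
case on: (odd n.+3); last first.
  rewrite prodS; first by apply: leq_trans (IH _ _) _; rewrite // leq_exp2l.
  by apply/negP => /even_prime[//|]; rewrite on.
have [m en] : exists m, n.+3 = m.*2.+1.
  by exists n.+3./2; rewrite -[LHS]odd_double_half on.
have m0 : 0 < m by case: m en.
rewrite en (primes_upto_split (m := m.+1)); last by rewrite ltnS -addnn leq_addr.
rewrite big_cat /=.
have -> : 4 ^ m.*2.+1 = 4 ^ m.+1 * 4 ^ m by rewrite -expnD -addnn addSn.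
apply: leq_mul.
  by apply: IH; rewrite en -addnn !ltnS -{1}[m]addn0 ltn_add2l.
apply: leq_trans (bin_odd_le m); apply: dvdn_leq.
  by rewrite bin_gt0 ltnW // ltnS -addnn leq_addr.
apply: prod_primes_dvd; first exact: (filter_uniq _ (primes_upto_uniq _)).
  by move=> p; rewrite mem_filter => /andP[_ /primes_upto_prime].
move=> p; rewrite mem_filter mem_primes_upto => /andP[mp /andP[pp pn]].
apply: prime_dvd_bin => //; first exact: ltnW.
  by rewrite -addnn subSn ?leq_addr // addnK.
by rewrite ltnW // ltnS -addnn leq_addr.
Qed.

Lemma ln_prod_primes_upto n :
  ln (INR (\prod_(p <- primes_upto n) p)) = \rsum_(p <- primes_upto n) ln (INR p).
Proof.
rewrite INR_prod ln_rprod // => p /primes_upto_prime pp.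
by apply: INR_gt0; apply: prime_gt0.
Qed.

Lemma theta_le n : (\rsum_(p <- primes_upto n) ln (INR p) <= 2 * ln 2 * INR n)%R.
Proof.
rewrite -ln_prod_primes_upto; apply: Rle_trans (_ : (ln (INR (4 ^ n)) <= _)%R).
  apply: ln_le; last by apply: leINR; apply: primorial_le.
  apply: INR_gt0; rewrite big_seq; apply: prodn_cond_gt0 => p /primes_upto_prime; exact: prime_gt0.
rewrite ln_INR_exp // (_ : INR 4 = 2 * 2)%R; last by rewrite /=; lra.
by rewrite ln_mult; lra.
Qed.

(** Legendre's sum is dominated by a geometric series; keeping the last quotient n / p^B on the left
    makes the induction telescope. *)
Lemma legendre_le p n : prime p -> logn p n`! * p.-1 <= n.
Proof.
move=> pp; rewrite logn_fact //.
suff h B : (\sum_(1 <= i < B.+1) n %/ p ^ i) * p.-1 + n %/ p ^ B <= n.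
  by apply: leq_trans (h n); rewrite leq_addr.
elim: B => [|B IH]; first by rewrite big_geq // expn0 divn1.
apply: leq_trans IH; rewrite big_nat_recr //= mulnDl -addnA leq_add2l.
rewrite -mulnSr prednK ?prime_gt0 // expnSr divnMA.
exact: leq_trunc_div.
Qed.

(** Divide n ln (n + 1) - n <= ln n! by n, after bounding the exponent of each prime p in n! by n /
    (p - 1). *)
Lemma mertens_lower n : 0 < n ->
  (ln (INR n.+1) - 1 <= \rsum_(p <- primes_upto n) (ln (INR p) / (INR p - 1)))%R.
Proof.
move=> n0; have x0 := INR_gt0 n0.
suff h : (INR n * (ln (INR n.+1) - 1)
          <= INR n * \rsum_(p <- primes_upto n) (ln (INR p) / (INR p - 1)))%R.
  exact: Rmult_le_reg_l h.
apply: Rle_trans (_ : (ln (INR n`!) <= _)%R); first by have := ln_fact_ge n; lra.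
rewrite (@ln_fact_primes n n) // -rsum_scale; apply: rsum_le => p /primes_upto_prime pp.
have p2 := INR_prime_ge2 pp.
have lp : (0 <= ln (INR p))%R by apply: ln_ge0; apply: prime_gt0.
have := leINR (legendre_le n pp); rewrite INRM INR_pred_prime // => h.
have -> : (INR n * (ln (INR p) / (INR p - 1)) = INR n / (INR p - 1) * ln (INR p))%R.
  by field; lra.
apply: Rmult_le_compat_r => //; apply/Rle_div_r; lra.
Qed.

Definition sum_inv_pred n := \rsum_(p <- primes_upto n) (1 / (INR p - 1)).
Definition sum_ln_pred n := \rsum_(p <- primes_upto n) (ln (INR p) / (INR p - 1)).
Definition euler_prod n := \rprod_(p <- primes_upto n) (1 - 1 / INR p).
(** The shift makes [lnS z] the logarithm of the next integer z + 1, so that when z + 1 is a prime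
    p, the increment 1 / (p - 1) is exactly that of [sum_ln_pred] divided by [lnS z]. *)
Definition lnS n := ln (INR n.+1).

Lemma ln_succ_gt0 n : 0 < n -> (0 < ln (INR n.+1))%R.
Proof.
move=> n0; rewrite -ln_1; apply: ln_increasing; first by lra.
by have := @ltINR 1 n.+1 n0.
Qed.

(* Abel summation against 1 / ln, with the boundary term kept so that the bound
   is preserved from z to z + 1. *)
Lemma mertens_abel z0 n : 0 < z0 ->
  (ln (lnS (z0 + n)) - ln (lnS z0) - (1 + sum_ln_pred z0 - lnS z0) / lnS z0
    + ((sum_ln_pred (z0 + n) - sum_ln_pred z0) - (lnS (z0 + n) - 1 - sum_ln_pred z0)) / lnS (z0 + n)
   <= sum_inv_pred (z0 + n) - sum_inv_pred z0)%R.
Proof.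
move=> z0_gt0; elim: n => [|n IH]; first by rewrite !addn0; lra.
rewrite addnS; set z := (z0 + n) in IH *.
have zp : 0 < z by rewrite /z addn_gt0 z0_gt0.
have lz : (0 < lnS z)%R by apply: ln_succ_gt0.
have lz1 : (0 < lnS z.+1)%R by apply: ln_succ_gt0.
have eF : (sum_inv_pred z.+1 - sum_inv_pred z = (sum_ln_pred z.+1 - sum_ln_pred z) / lnS z)%R.
  rewrite /sum_inv_pred /sum_ln_pred primes_upto_S !big_cat /=; case: ifP => pr; last by rewrite !big_nil /Rdiv; ring.
  rewrite !big_seq1 /lnS; have := INR_prime_ge2 pr => h; field; split; first by lra.
  by rewrite -/(lnS z); lra.
have hS := mertens_lower (ltn0Sn z).
rewrite -/(sum_ln_pred z.+1) -/(lnS z.+1) in hS.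
have mono : (lnS z <= lnS z.+1)%R.
  by apply: ln_le; [apply: INR_gt0 | apply: leINR].
have hl : (ln (lnS z.+1) <= ln (lnS z) + (lnS z.+1 / lnS z - 1))%R by apply: ln_tangent.
have inv : (/ lnS z.+1 <= / lnS z)%R by apply: Rinv_le_contravar.
(* By [mertens_lower] the boundary numerator at z + 1 is nonnegative, so enlarging its denominator
   from [lnS z] to [lnS z.+1] only lowers the left side. *)
have key : (0 <= (sum_ln_pred z.+1 - sum_ln_pred z0 - (lnS z.+1 - 1 - sum_ln_pred z0)) * (/ lnS z - / lnS z.+1))%R.
  by apply: Rmult_le_pos; lra.
have e1 : (lnS z.+1 / lnS z - 1 = (lnS z.+1 - lnS z) / lnS z)%R by field; lra.
rewrite e1 in hl.
move: IH eF hl key; rewrite /Rdiv; nra.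
Qed.

(** Use 1 - 1/p <= exp (-1/p) and 1/p = 1/(p-1) - (1/(p-1) - 1/p). The corrections, extended from
    primes to all integers, telescope to 1/z0 - 1/(z0 + n). *)
Lemma mertens_prod_exp z0 n : 0 < z0 ->
  (0 <= euler_prod (z0 + n) <= euler_prod z0 * exp (sum_inv_pred z0 - sum_inv_pred (z0 + n) + / INR z0 - / INR (z0 + n)))%R.
Proof.
move=> z0_gt0; elim: n => [|n IH].
  have -> : (sum_inv_pred z0 - sum_inv_pred (z0 + 0) + / INR z0 - / INR (z0 + 0) = 0)%R by rewrite addn0; ring.
  rewrite addn0 exp_0; split; last by lra.
  apply: Rlt_le; apply: rprod_gt0 => p /primes_upto_prime /INR_prime_ge2 h.
  have : (1 / INR p <= 1 / 2)%R by apply/Rle_div_l; [lra|]; lra.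
  by lra.
rewrite addnS; set z := (z0 + n) in IH *.
have zp : 0 < z by rewrite /z addn_gt0 z0_gt0.
have z1 : (0 < INR z)%R by apply: INR_gt0.
have e1 : INR z.+1 = (INR z + 1)%R by rewrite S_INR.
have inv : (/ INR z.+1 <= / INR z)%R by apply: Rinv_le_contravar; lra.
have i0 : (0 < / INR z.+1)%R by apply: Rinv_0_lt_compat; lra.
have V0 : (0 <= euler_prod z0)%R.
  have := exp_pos (sum_inv_pred z0 - sum_inv_pred z + / INR z0 - / INR z); nra.
have eV : euler_prod z.+1 = (euler_prod z * if prime z.+1 then 1 - / INR z.+1 else 1)%R.
  rewrite /euler_prod primes_upto_S big_cat; case: ifP => _; last by rewrite big_nil.
  by rewrite big_seq1 /Rdiv Rmult_1_l.
have eF : sum_inv_pred z.+1 = (sum_inv_pred z + if prime z.+1 then / (INR z.+1 - 1) else 0)%R.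
  rewrite /sum_inv_pred primes_upto_S big_cat; case: ifP => _; last by rewrite big_nil.
  by rewrite big_seq1 /Rdiv Rmult_1_l.
rewrite eV eF; case: ifP => pr; last first.
  rewrite Rmult_1_r Rplus_0_r; split; first by lra.
  apply: Rle_trans (_ : (_ <= euler_prod z0 * exp (sum_inv_pred z0 - sum_inv_pred z + / INR z0 - / INR z))%R) _; first by lra.
  by apply: Rmult_le_compat_l => //; apply: exp_le_mono; lra.
have q1 : (/ INR z.+1 <= 1)%R by rewrite -Rinv_1; apply: Rinv_le_contravar; lra.
split; first by apply: Rmult_le_pos; lra.
have -> : (sum_inv_pred z0 - (sum_inv_pred z + / (INR z.+1 - 1)) + / INR z0 - / INR z.+1
  = (sum_inv_pred z0 - sum_inv_pred z + / INR z0 - / INR z) + - / INR z.+1)%R.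
  by rewrite (_ : INR z.+1 - 1 = INR z)%R; [ring | lra].
rewrite exp_plus -Rmult_assoc; apply: Rmult_le_compat; try lra.
by have := exp_ineq1_le (- / INR z.+1); lra.
Qed.

(** Insert [mertens_abel] into [mertens_prod_exp], discarding the boundary term, which is
    nonnegative at z, and the term -1/z. The exponential of the difference of iterated logarithms is
    the ratio of logarithms. *)
Lemma mertens_prod z0 z : 0 < z0 -> z0 <= z ->
  (\rprod_(p <- primes_upto z) (1 - 1 / INR p) <=
   \rprod_(p <- primes_upto z0) (1 - 1 / INR p) * (ln (INR z0.+1) / ln (INR z.+1)) *
   exp ((1 + \rsum_(p <- primes_upto z0) (ln (INR p) / (INR p - 1)) - ln (INR z0.+1)) / ln (INR z0.+1)
        + / INR z0))%R.
Proof.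
move=> z0_gt0 h; rewrite -(subnKC h); set n := (z - z0).
rewrite -/(euler_prod z0) -/(euler_prod (z0 + n)) -/(sum_ln_pred z0) -/(lnS z0) -/(lnS (z0 + n)).
have [_ hV] := mertens_prod_exp n z0_gt0; have hA := mertens_abel n z0_gt0.
have zp : 0 < z0 + n by rewrite addn_gt0 z0_gt0.
have lz : (0 < lnS (z0 + n))%R by apply: ln_succ_gt0.
have lz0 : (0 < lnS z0)%R by apply: ln_succ_gt0.
have hS := mertens_lower zp; rewrite -/(sum_ln_pred (z0 + n)) -/(lnS (z0 + n)) in hS.
have hr : (0 <= ((sum_ln_pred (z0 + n) - sum_ln_pred z0) - (lnS (z0 + n) - 1 - sum_ln_pred z0)) / lnS (z0 + n))%R.
  by apply: Rle_mult_inv_pos; lra.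
have i0 : (0 < / INR (z0 + n))%R by apply: Rinv_0_lt_compat; apply: INR_gt0.
have V0 : (0 <= euler_prod z0)%R.
  by have [] := mertens_prod_exp 0 z0_gt0; rewrite addn0.
apply: Rle_trans hV _; rewrite Rmult_assoc; apply: Rmult_le_compat_l => //.
have -> : (lnS z0 / lnS (z0 + n) = exp (ln (lnS z0) - ln (lnS (z0 + n))))%R.
  by rewrite -ln_div // exp_ln //; apply: Rdiv_lt_0_compat.
by rewrite -exp_plus; apply: exp_le_mono; lra.
Qed.


(** * Numerical data for primes up to 8000 *)

(** The primes below 97, enough to decide primality below 97^2 and thus up to 8000. *)
Definition trial_divisors : seq N :=
  [:: 2; 3; 5; 7; 11; 13; 17; 19; 23; 29; 31; 37; 41; 43; 47; 53; 59; 61; 67;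
      71; 73; 79; 83; 89]%num.

(** The escape clause on d * d keeps a prime from being rejected by itself. *)
Definition primeN (n : N) : bool :=
  N.ltb 1 n && all (fun d => N.ltb n (d * d) || ~~ N.eqb (n mod d) 0) trial_divisors.

(** The bit length of n^32 exceeds 32 log_2 n by at most 1, so it yields ln n up to an error of ln 2
    / 32 by integer arithmetic alone. *)
Definition exp32 (n : N) : N :=
  let sq x := N.mul x x in sq (sq (sq (sq (sq n)))).

(* Position, number of primes, 32/ln 2 times theta, 32 * 10^6 / ln 2 times the
   sum of ln p / (p - 1) and 10^12 times the product of 1 - 1/p, the last three
   rounded up. *)
Record prime_stats := PrimeStats
  { st_pos : N; st_pi : N; st_theta : N; st_mertens : N; st_euler : N }.

(** At a prime n the previous position i equals n - 1: it is the denominator in the Mertens sum, and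
    i / n is the Euler factor. Each [N.succ] rounds a truncated quotient up. *)
Definition stats_step (s : prime_stats) : prime_stats :=
  let: PrimeStats i c t m v := s in
  let n := N.succ i in
  if primeN n then
    let b := N.size (exp32 n) in
    PrimeStats n (N.succ c) (t + b) (m + N.succ (b * 1000000 / i)) (N.succ (v * i / n))
  else PrimeStats n c t m v.

Fixpoint stats (n : nat) : prime_stats :=
  if n is n'.+1 then stats_step (stats n') else PrimeStats 0 0 0 0 1000000000000.

Definition NR (a : N) : R := IZR (Z.of_N a).


(** The least prime factor of a composite n < 97^2 is below 97, hence at most 89, and its square is
    at most n, so the corresponding trial division rejects n. *)
Lemma primeN_spec (n : nat) : n < 97 ^ 2 -> primeN (N.of_nat n) = prime n.
Proof.
move=> n97; rewrite /primeN.
have e1 : N.ltb 1 (N.of_nat n) = (1 < n).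
  by apply/idP/idP => [/N.ltb_lt h | /ltP h]; [apply/ltP | apply/N.ltb_lt]; lia.
rewrite e1; case: (ltnP 1 n) => [n1|n1]; last first.
  by case: n n1 {n97 e1} => [|[|n]].
have -> : trial_divisors = [seq N.of_nat d | d <- primes_upto 89] by vm_compute.
rewrite andTb all_map.
have eb d : d \in primes_upto 89 -> (N.ltb (N.of_nat n) (N.of_nat d * N.of_nat d)
    || ~~ N.eqb (N.of_nat n mod N.of_nat d) 0) = (n < d * d) || ~~ (d %| n).
  move=> /primes_upto_prime /prime_gt0 d0; congr (_ || ~~ _).
    apply/idP/idP => [/N.ltb_lt h | /ltP h]; [apply/ltP | apply/N.ltb_lt];
    rewrite -multE in h *; lia.
  apply/idP/idP => [/N.eqb_eq h|/dvdnP[q ->]].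
    apply/dvdnP; exists (N.to_nat (N.of_nat n / N.of_nat d)).
    have := N.div_mod (N.of_nat n) (N.of_nat d) ltac:(by case: d d0 {h}).
    rewrite h -multE; lia.
  apply/N.eqb_eq; rewrite -multE Nat2N.inj_mul; apply: N.Div0.mod_mul.
have -> : all (preim N.of_nat (fun d => N.ltb (N.of_nat n) (d * d)
    || ~~ N.eqb (N.of_nat n mod d) 0)) (primes_upto 89) = all (fun d => (n < d * d) || ~~ (d %| n)) (primes_upto 89).
  by apply: eq_in_all => d hd /=; rewrite eb.
apply/allP/idP => [h|pn d /primes_upto_prime pd]; last first.
  case: (ltnP n (d * d)) => //= dn; rewrite dvdn_prime2 //; apply/eqP => e; subst d.
  by move: dn; rewrite leqNgt -{1}[n]mul1n ltn_pmul2r ?prime_gt1 ?prime_gt0.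
apply/negPn/negP => np.
have pp := pdiv_prime n1; have pd := pdiv_dvd n.
have sq : pdiv n * pdiv n <= n.
  rewrite leqNgt; apply/negP => hl; move/negP: np; apply.
  by apply: ltn_pdiv2_prime; rewrite ?(ltnW n1) // -mulnn.
have p97 : pdiv n < 97.
  by rewrite -(ltn_exp2r _ _ (isT : 0 < 2)) (leq_ltn_trans _ n97) // -mulnn.
have p89 : pdiv n \in primes_upto 89.
  have <- : primes_upto 96 = primes_upto 89 by vm_compute.
  by rewrite mem_primes_upto pp.
by have := h (pdiv n) p89; rewrite pd orbF ltnNge sq.
Qed.

Lemma NR_succ a : NR (N.succ a) = (NR a + 1)%R.
Proof. by rewrite /NR N2Z.inj_succ succ_IZR. Qed.

Lemma NR_add a b : NR (a + b) = (NR a + NR b)%R.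
Proof. by rewrite /NR N2Z.inj_add plus_IZR. Qed.

Lemma NR_mul a b : NR (a * b) = (NR a * NR b)%R.
Proof. by rewrite /NR N2Z.inj_mul mult_IZR. Qed.

Lemma NR_of_nat n : NR (N.of_nat n) = INR n.
Proof. by rewrite /NR nat_N_Z INR_IZR_INZ. Qed.

Lemma NR_div_le a b : (0 < NR b)%R -> (NR a / NR b <= NR (N.succ (a / b)))%R.
Proof.
move=> b0; apply/Rle_div_l => //; rewrite -NR_mul; apply: IZR_le.
have hb : b <> 0%num by move=> e; move: b0; rewrite e /NR /=; lra.
by have := N.mul_succ_div_gt a b hb; lia.
Qed.

Lemma ln_le_size32 n : 0 < n ->
  (ln (INR n) <= ln 2 / 32 * NR (N.size (exp32 (N.of_nat n))))%R.
Proof.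
move=> n0; have x0 := INR_gt0 n0.
have e32 : NR (exp32 (N.of_nat n)) = (INR n ^ 32)%R.
  by rewrite /exp32 !NR_mul NR_of_nat; ring.
set b := N.size _.
have hb : (INR n ^ 32 <= 2 ^ (N.to_nat b))%R.
  rewrite -e32 /NR pow_IZR; apply: IZR_le.
  have := N.size_gt (exp32 (N.of_nat n)); rewrite -/b => h.
  have -> : (2 ^ Z.of_nat (N.to_nat b))%Z = Z.of_N (2 ^ b) by rewrite N2Z.inj_pow; congr Z.pow; lia.
  by lia.
have := ln_le _ _ (pow_lt _ 32 x0) hb.
rewrite !ln_pow //; last by lra.
rewrite -(NR_of_nat (N.to_nat b)) N2Nat.id (_ : INR 32 = 32)%R; last by rewrite INR_IZR_INZ.
by lra.
Qed.

Lemma stats_spec n : n < 97 ^ 2 ->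
  [/\ st_pos (stats n) = N.of_nat n,
      INR (size (primes_upto n)) = NR (st_pi (stats n)),
      (\rsum_(p <- primes_upto n) ln (INR p) <= ln 2 / 32 * NR (st_theta (stats n)))%R,
      (\rsum_(p <- primes_upto n) (ln (INR p) / (INR p - 1))
         <= ln 2 / 32 * (NR (st_mertens (stats n)) / 1000000))%R
    & (\rprod_(p <- primes_upto n) (1 - 1 / INR p) <= NR (st_euler (stats n)) / 1000000000000)%R].
Proof.
have l2 : (0 < ln 2 / 32)%R by have := ln2_bounds; lra.
elim: n => [|n IH] hn.
  rewrite (_ : primes_upto 0 = [::]) // !big_nil /NR /=; split=> //; lra.
rewrite [stats n.+1]/(stats_step (stats n)).
have [] := IH (ltnW hn); case e: (stats n) => [i c t m v].
cbn [st_pos st_pi st_theta st_mertens st_euler] => hi hc ht hm hv.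
rewrite /stats_step hi -Nat2N.inj_succ primeN_spec //.
case: ifP => pr; last by rewrite primes_upto_S pr cats0.
have p2 := INR_prime_ge2 pr.
have n0 : 0 < n by case: n pr {IH hn e hi hc ht hm hv p2}.
have x0 := INR_gt0 n0.
have eS : INR n.+1 = (INR n + 1)%R by rewrite S_INR.
rewrite !rsum_primes_upto_prime // rprod_primes_upto_prime // (_ : size (primes_upto n.+1) = (size (primes_upto n)).+1); last first.
  by rewrite primes_upto_S pr size_cat addn1.
have hl := ln_le_size32 (ltn0Sn n).
move: hl; set b := N.size (exp32 (N.of_nat n.+1)) => hl.
cbn [st_pos st_pi st_theta st_mertens st_euler].
split=> //.
- by rewrite S_INR NR_succ hc.
- by rewrite NR_add; lra.
- rewrite NR_add.
  have := @NR_div_le (b * 1000000) (N.of_nat n); rewrite NR_of_nat => /(_ x0).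
  rewrite NR_mul (_ : NR 1000000 = 1000000)%R // => h.
  have : (ln (INR n.+1) / (INR n.+1 - 1) <= ln 2 / 32 * (NR b * 1000000 / INR n / 1000000))%R.
    have -> : (ln 2 / 32 * (NR b * 1000000 / INR n / 1000000) = ln 2 / 32 * NR b / INR n)%R.
      by field; lra.
    have -> : (INR n.+1 - 1 = INR n)%R by lra.
    by apply: Rmult_le_compat_r => //; apply/Rlt_le/Rinv_0_lt_compat.
  move: (Rmult_le_compat_l _ _ _ (Rlt_le _ _ l2) h); lra.
- have := @NR_div_le (v * N.of_nat n) (N.of_nat n.+1); rewrite NR_of_nat => /(_ ltac:(lra)).
  rewrite NR_mul NR_of_nat => h.
  apply: Rle_trans (_ : (_ <= NR v / 1000000000000 * (INR n / INR n.+1))%R) _.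
    rewrite (_ : (1 - 1 / INR n.+1 = INR n / INR n.+1)%R); last by rewrite eS; field; lra.
    by apply: Rmult_le_compat_r => //; apply: Rle_mult_inv_pos; lra.
  by move: h; rewrite /Rdiv; lra.
Qed.

Lemma stats_1000 : stats 1000 = PrimeStats 1000 168 44229 295605669 80965263571.
Proof. by vm_compute. Qed.

Lemma stats_2000 : stats 2000 = PrimeStats 2000 303 89704 327242030 73671608831.
Proof. by vm_compute. Qed.

Lemma stats_4000 : stats 4000 = PrimeStats 4000 550 180842 358877552 67590493339.
Proof. by vm_compute. Qed.

Lemma stats_8000 : stats 8000 = PrimeStats 8000 1007 364068 390694167 62411614686.
Proof. by vm_compute. Qed.

Definition prime_data (z : nat) (c t v : R) : Prop :=
  [/\ (INR (size (primes_upto z)) <= c)%R,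
      (\rsum_(p <- primes_upto z) ln (INR p) <= t)%R
    & (\rprod_(p <- primes_upto z) (1 - 1 / INR p) <= v)%R].

Lemma prime_data_1000 : prime_data 1000 168 959 0.080966.
Proof.
have [_] := @stats_spec 1000 isT; rewrite stats_1000.
cbn [st_pos st_pi st_theta st_mertens st_euler]; rewrite /NR.
cbn [Z.of_N] => hc ht _ hv; have := ln2_bounds; split; lra.
Qed.

Lemma prime_data_2000 : prime_data 2000 303 1945 0.073672.
Proof.
have [_] := @stats_spec 2000 isT; rewrite stats_2000.
cbn [st_pos st_pi st_theta st_mertens st_euler]; rewrite /NR.
cbn [Z.of_N] => hc ht _ hv; have := ln2_bounds; split; lra.
Qed.

Lemma prime_data_4000 : prime_data 4000 550 3920 0.067591.
Proof.
have [_] := @stats_spec 4000 isT; rewrite stats_4000.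
cbn [st_pos st_pi st_theta st_mertens st_euler]; rewrite /NR.
cbn [Z.of_N] => hc ht _ hv; have := ln2_bounds; split; lra.
Qed.

Lemma prime_data_8000 : prime_data 8000 1007 7891 0.062412.
Proof.
have [_] := @stats_spec 8000 isT; rewrite stats_8000.
cbn [st_pos st_pi st_theta st_mertens st_euler]; rewrite /NR.
cbn [Z.of_N] => hc ht _ hv; have := ln2_bounds; split; lra.
Qed.

Lemma INR_8000 : INR 8000 = 8000%R.
Proof. by rewrite INR_IZR_INZ. Qed.

(** [mertens_prod] started at 8000 with the computed sums. The constant 0.594 compares with the true
    limit e^(-gamma), about 0.5615. *)
Lemma euler_prod_le z : 8000 <= z ->
  (\rprod_(p <- primes_upto z) (1 - 1 / INR p) <= 0.594 / ln (INR z.+1))%R.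
Proof.
move=> hz; have := mertens_prod (isT : 0 < 8000) hz.
have [_ _ _] := @stats_spec 8000 isT; rewrite stats_8000.
cbn [st_pos st_pi st_theta st_mertens st_euler]; rewrite /NR; cbn [Z.of_N].
have -> : INR 8001 = (8000 + 1)%R by rewrite S_INR INR_8000.
rewrite INR_8000.
set S := \rsum_(p <- primes_upto 8000) _; set V0 := \rprod_(p <- primes_upto 8000) _.
have V0p : (0 <= V0)%R.
  apply: Rlt_le; apply: rprod_gt0 => p /primes_upto_prime /INR_prime_ge2 h.
  have : (1 / INR p <= 1 / 2)%R by apply/Rle_div_l; [lra|]; lra.
  by lra.
move=> hS hV; set t := ln (8000 + 1).
have l0 : (ln 8000 = 6 * ln 2 + 3 * ln 5)%R.
  rewrite (_ : 8000 = 2 ^ 6 * 5 ^ 3)%R; last by lra.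
  by rewrite ln_mult ?ln_pow /=; lra.
have [t1 t2] : (8.984 <= t <= 8.993)%R.
  have := @ln_le 8000 (8000 + 1) ltac:(lra) ltac:(lra).
  have := @ln_tangent 8000 (8000 + 1) ltac:(lra) ltac:(lra).
  by rewrite -/t l0; have := ln2_bounds; have := ln5_bounds; lra.
have lz : (0 < ln (INR z.+1))%R by apply: ln_succ_gt0; apply: leq_trans hz.
have hS' : (S <= 8.4676)%R by have := ln2_bounds; lra.
have hE : (exp ((1 + S - t) / t + / 8000) <= 1.0571)%R.
  have hx : ((1 + S - t) / t + / 8000 <= 0.054)%R.
    suff : ((1 + S - t) / t <= 0.05386)%R by lra.
    by apply/Rle_div_l; lra.
  (* The upper bound for exp 0.054 is the inverse of the lower bound exp (-0.054) >= 0.946. *)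
  have := exp_ineq1_le (Ropp 0.054); rewrite exp_Ropp => h.
  apply: Rle_trans (exp_le_mono hx) _.
  have ep := exp_pos 0.054.
  have h2 := Rmult_le_compat_l _ _ _ (Rlt_le _ _ ep) h.
  by rewrite Rinv_r in h2; lra.
move=> h; apply: Rle_trans h _.
have -> : (V0 * (t / ln (INR z.+1)) * exp ((1 + S - t) / t + / 8000)
  = V0 * t * exp ((1 + S - t) / t + / 8000) / ln (INR z.+1))%R by field; lra.
apply: Rmult_le_compat_r; first by apply/Rlt_le/Rinv_0_lt_compat.
have ep := exp_pos ((1 + S - t) / t + / 8000).
apply: Rle_trans (_ : (_ <= 0.062412 * 8.993 * 1.0571)%R) _; last by lra.
by apply: Rmult_le_compat; try lra; [nra | nra].
Qed.

(** * Sieving the terms of a residue class *)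

Lemma dvdn_add_mul_cong p c c' i k :
  c = c' %[mod p] -> (p %| c + i * k) = (p %| c' + i * k).
Proof. by move=> h; rewrite /dvdn -(modnDml c) h modnDml. Qed.

Lemma cong_dvd c c' m p : p %| m -> c = c' %[mod m] -> c = c' %[mod p].
Proof. by move=> pm h; rewrite -(modn_dvdm c pm) h modn_dvdm. Qed.

Lemma coprime_prod_primes p (s : seq nat) : prime p -> (forall q, q \in s -> prime q) ->
  p \notin s -> coprime (\prod_(q <- s) q) p.
Proof.
move=> pp hs ps; rewrite coprime_sym prime_coprime // Euclid_dvd_prod // big_has.
apply/hasPn => q qs; rewrite (dvdn_prime2 pp (hs _ qs)).
by apply: contra ps => /eqP->.
Qed.

(** The p residue classes partition r, so their counts cannot all be below the average. *)
Lemma residue_pigeonhole p (r : seq nat) : 0 < p ->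
  exists2 a, a < p & size r <= p * count (fun i => i %% p == a) r.
Proof.
move=> p0; case: (boolP [forall a : 'I_p, p * count (fun i => i %% p == a) r < size r]) => h; last first.
  move: h; rewrite negb_forall => /existsP[a]; rewrite -leqNgt => ha; by exists a.
have hs : size r = \sum_(a < p) count (fun i => i %% p == a) r.
  elim: r {h} => [|i r IH]; first by rewrite big1.
  rewrite /= IH big_split /= -add1n; congr (_ + _).
  rewrite (bigD1 (Ordinal (ltn_pmod i p0))) //= eqxx big1 // => a.
  by rewrite -val_eqE /= eq_sym => /negbTE->.
have : p * size r < p * size r.
  rewrite {1}hs big_distrr /= -[X in _ < X * _](card_ord p) -sum_nat_const.
  have h' a : p * count (fun i => i %% p == a) r < size r \/ p <= a.
    by case: (ltnP a p) => ap; [left; exact: (forallP h (Ordinal ap)) | right].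
  rewrite (bigD1 (Ordinal p0)) //= [X in _ < X](bigD1 (Ordinal p0)) //=.
  rewrite -addSn; apply: leq_add; first exact: (forallP h (Ordinal p0)).
  by apply: leq_sum => a _; apply: ltnW; exact: (forallP h a).
by rewrite ltnn.
Qed.

(** Primes dividing k are passed over: such a p divides either every term c + i k or none. *)
Definition survivors (k c : nat) (s r : seq nat) : seq nat :=
  [seq i <- r | all (fun p => (p %| k) || ~~ (p %| c + i * k)) s].

(** Induction on s by the Chinese remainder theorem. A prime p not dividing k receives the residue
    that kills the most frequent class of surviving indices, leaving at most a fraction 1 - 1/p of
    them; a prime dividing k receives residue 1. Denominators are cleared to stay in the
    integers. *)
Lemma greedy_residues k (s r : seq nat) : uniq s -> (forall p, p \in s -> prime p) ->
  exists c, (forall p, p \in s -> p %| k -> c = 1 %[mod p]) /\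
    size (survivors k c s r) * \prod_(p <- s | ~~ (p %| k)) p
      <= size r * \prod_(p <- s | ~~ (p %| k)) p.-1.
Proof.
elim: s => [|p s IH]; first by exists 0; split=> //; rewrite !big_nil /survivors filter_predT.
move=> /= /andP[ps us] hp.
have pp : prime p by apply: hp; rewrite inE eqxx.
have hs q : q \in s -> prime q by move=> qs; apply: hp; rewrite inE qs orbT.
have [c [hc1 hc2]] := IH us hs.
have co := coprime_prod_primes pp hs ps.
pose m := \prod_(q <- s) q.
have qm q : q \in s -> q %| m.
  by move=> qs; rewrite /m (big_rem q) //= dvdn_mulr.
have surv c' : c' = c %[mod m] -> forall i,
    all (fun q => (q %| k) || ~~ (q %| c' + i * k)) s
    = all (fun q => (q %| k) || ~~ (q %| c + i * k)) s.
  move=> hc i; apply: eq_in_all => q qs; congr (_ || ~~ _).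
  exact: dvdn_add_mul_cong (cong_dvd (qm q qs) hc).
case: (boolP (p %| k)) => pk.
  exists (chinese m p c 1); split.
    move=> q; rewrite inE => /orP[/eqP->|qs] qk; first by rewrite chinese_modr.
    by rewrite (cong_dvd (qm q qs) (chinese_modl co c 1)) hc1.
  rewrite !big_cons pk /=; suff -> : survivors k (chinese m p c 1) (p :: s) r = survivors k c s r by [].
  by apply: eq_filter => i /=; rewrite pk surv // chinese_modl.
have [a ap ha] := residue_pigeonhole (survivors k c s r) (prime_gt0 pp).
(* d is -a k modulo p, so p divides d + i k whenever i is congruent to a. *)
pose d := p.-1 * (a * k).
exists (chinese m p c d); split.
  move=> q; rewrite inE => /orP[/eqP->|qs] qk; first by rewrite qk in pk.
  by rewrite (cong_dvd (qm q qs) (chinese_modl co c d)) hc1.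
have le : p * size (survivors k (chinese m p c d) (p :: s) r) <= p.-1 * size (survivors k c s r).
  rewrite -{1}[p]prednK ?prime_gt0 // mulSn.
  have sz : size (survivors k (chinese m p c d) (p :: s) r) + count (fun i => i %% p == a) (survivors k c s r)
      <= size (survivors k c s r).
    rewrite -[X in _ <= X](count_predC (fun i => i %% p == a)) addnC leq_add2l.
    rewrite -size_filter /survivors -filter_predI !size_filter; apply: sub_count => i /=.
    rewrite (negbTE pk) /= surv ?chinese_modl // => /andP[hpi ->]; rewrite andbT.
    apply: contra hpi => /eqP hi.
    rewrite (dvdn_add_mul_cong i k (chinese_modr co c d)).
    rewrite /dvdn -modnDmr -(modnMml i k) hi modnDmr /d -mulSnr prednK ?prime_gt0 //.
    by rewrite modnMr.
  (* With C indices killed, S' + C <= S and S <= p C give p S' <= (p - 1) S; C p is added to both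
     sides to avoid truncated subtraction. *)
  rewrite -(leq_add2r (count (fun i => i %% p == a) (survivors k c s r) * p)).
  set S' := size (survivors k (chinese m p c d) (p :: s) r) in sz *.
  set S := size (survivors k c s r) in sz ha *; set C := count _ _ in sz ha *.
  rewrite [p * C]mulnC in ha.
  have h1 := leq_mul (leqnn p.-1) sz.
  have hp1 : p = p.-1.+1 by rewrite prednK ?prime_gt0.
  have h3 : (S' + C) * p <= S * p by rewrite leq_mul2r sz orbT.
  have e1 : S * p = p.-1 * S + S by rewrite mulnC {1}hp1 mulSn addnC.
  have e2 : (S' + C) * p = S' + p.-1 * S' + C * p by rewrite mulnDl mulnC {1}hp1 mulSn.
  rewrite -e2; apply: leq_trans h3 _; rewrite e1 leq_add2l.
  exact: ha.
rewrite !big_cons pk mulnA [size _ * p]mulnC.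
apply: leq_trans (leq_mul le (leqnn _)) _.
by rewrite -mulnA [size r * _]mulnCA leq_mul.
Qed.

(** One fresh prime per remaining index: the residue (q - 1) i k, which is -i k modulo q, makes q
    divide the term of index i, and the modulus grows to m q before the next index is treated. *)
Lemma assign_residues k (r s : seq nat) m c : size r <= size s -> uniq s ->
  (forall q, q \in s -> prime q) -> (forall q, q \in s -> coprime m q) ->
  exists2 c', c' = c %[mod m] &
    forall i, i \in r -> exists2 q, q \in take (size r) s & q %| c' + i * k.
Proof.
elim: r s m c => [|i r IH] [|q s] m c //=; try by exists c.
rewrite ltnS => rs /andP[qs us] hp hm.
have pq : prime q by apply: hp; rewrite inE eqxx.
have cq : coprime m q by apply: hm; rewrite inE eqxx.
have hp' q' : q' \in s -> prime q' by move=> h; apply: hp; rewrite inE h orbT.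
have hm' q' : q' \in s -> coprime (m * q) q'.
  move=> h; rewrite coprimeMl hm ?inE ?h ?orbT //=.
  rewrite prime_coprime // (dvdn_prime2 pq (hp' _ h)).
  by apply: contra qs => /eqP->.
have [c' hc' hr] := IH s (m * q) (chinese m q c (q.-1 * (i * k))) rs us hp' hm'.
exists c'; first by rewrite (cong_dvd (dvdn_mulr q (dvdnn m)) hc') chinese_modl.
move=> j; rewrite inE => /orP[/eqP->|/hr[q' q's h]]; last by exists q'; rewrite // inE q's orbT.
exists q; first by rewrite inE eqxx.
rewrite (dvdn_add_mul_cong i k (cong_dvd (dvdn_mull m (dvdnn q)) hc')).
rewrite (dvdn_add_mul_cong i k (chinese_modr cq _ _)).
by rewrite -mulSnr prednK ?prime_gt0 // dvdn_mulr.
Qed.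

Lemma count_window (P : pred nat) p T n : n <= p ->
  (forall t t', P t -> P t' -> t = t' %[mod p]) -> count P (iota T n) <= 1.
Proof.
move=> np hP; rewrite -size_filter.
have := filter_uniq P (iota_uniq T n).
have : forall t, t \in [seq t <- iota T n | P t] -> P t /\ T <= t < T + n.
  by move=> t; rewrite mem_filter mem_iota => /andP[].
case: [seq t <- iota T n | P t] => [|a [|b l]] //= h /andP[ab _].
have [Pa /andP[a1 a2]] := h a ltac:(by rewrite !inE eqxx).
have [Pb /andP[b1 b2]] := h b ltac:(by rewrite !inE eqxx orbT).
move: ab; rewrite inE negb_or => /andP[/eqP ab _]; case: ab.
rewrite -(subnKC a1) -(subnKC b1); congr (_ + _).
have : a - T = b - T %[mod p].
  by apply/eqP; rewrite -(eqn_modDl T) !subnKC //; apply/eqP; exact: hP.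
have ha : a - T < p by rewrite (leq_trans _ np) // ltn_subLR.
have hb : b - T < p by rewrite (leq_trans _ np) // ltn_subLR.
by rewrite !modn_small.
Qed.

Lemma count_residue (P : pred nat) p T n : 0 < p ->
  (forall t t', P t -> P t' -> t = t' %[mod p]) -> count P (iota T n) <= n %/ p + 1.
Proof.
move=> p0 hP; elim/ltn_ind: n T => n IH T.
case: (leqP p n) => h; last first.
  by rewrite divn_small // (count_window _ _ hP) // ltnW.
rewrite -{1}(subnKC h) iotaD count_cat addn1 -addn1 addnC.
apply: leq_trans (leq_add (IH (n - p) _ (T + p)) (count_window T (leqnn p) hP)) _.
  by rewrite ltn_subrL p0 (leq_trans p0 h).
by rewrite leq_add2r -{2}(subnK h) divnDr // divnn p0.
Qed.

(** Union bound: since m is invertible modulo p, the bad t lie in one class modulo p, which meets a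
    window of length n at most n / p + 1 times. *)
Lemma avoid_residues (D : seq nat) m c T n :
  (forall p, p \in D -> prime p /\ coprime m p) ->
  \sum_(p <- D) (n %/ p + 1) < n ->
  exists t, [/\ T <= t, t < T + n & forall p, p \in D -> ~~ (p %| c + m * t)].
Proof.
move=> hD hs.
suff : count (fun t => has (fun p => p %| c + m * t) D) (iota T n) < n.
  rewrite -{2}(size_iota T n) -(count_predC (fun t => has (fun p => p %| c + m * t) D)).
  rewrite -[X in X < _]addn0 ltn_add2l -has_count => /hasP[t].
  rewrite mem_iota => /andP[t1 t2] /= /hasPn h; by exists t.
apply: leq_ltn_trans hs.
elim: D hD => [|p D IH] hD; first by rewrite big_nil /= count_pred0.
rewrite big_cons /=.
apply: leq_trans (_ : count (fun t => p %| c + m * t) (iota T n)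
  + count (fun t => has (fun p => p %| c + m * t) D) (iota T n) <= _).
  by rewrite -count_predUI leq_addr.
have [pp co] := hD p ltac:(by rewrite inE eqxx).
apply: leq_add; last by apply: IH => q hq; apply: hD; rewrite inE hq orbT.
apply: count_residue; first exact: prime_gt0.
move=> t t' /= h1 h2.
wlog tt : t t' h1 h2 / t <= t'.
  by move=> W; case: (leqP t t') => h; [apply: W | apply/esym/W => //; apply: ltnW].
apply/eqP; rewrite eq_sym eqn_mod_dvd //.
rewrite -(@Gauss_dvdr p m) 1?coprime_sym // mulnBr.
by rewrite -(subnDl c) dvdn_sub.
Qed.

Lemma prod_take_le (s : seq nat) M Q : (forall q, q \in s -> q <= Q) ->
  \prod_(q <- take M s) q <= Q ^ size (take M s).
Proof.
move=> h; have {h} : forall q, q \in take M s -> q <= Q by move=> q /mem_take /h.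
elim: (take M s) => [|a l IH] h; first by rewrite big_nil.
rewrite big_cons expnS leq_mul ?h ?inE ?eqxx // IH // => q ql.
by apply: h; rewrite inE ql orbT.
Qed.

(** The hypotheses say, in order: at most M indices survive the greedy stage; (z, Q] holds M primes
    to kill them; the union bound for the prime divisors of k above z succeeds; the resulting a is
    at most k. The residues fix a modulo m, and the multiple m t secures coprimality to the large
    prime divisors of k. *)
Lemma sieve_class (k z Q L M n : nat) :
  1 < k -> 0 < Q -> z <= Q ->
  L * \prod_(p <- primes_upto z | ~~ (p %| k)) p.-1 < M.+1 * \prod_(p <- primes_upto z | ~~ (p %| k)) p ->
  M <= size [seq p <- primes_upto Q | (z < p) && ~~ (p %| k)] ->
  \sum_(p <- primes k | z < p) (n %/ p + 1) < n ->
  (\prod_(p <- primes_upto z) p) * Q ^ M * (Q + n).+1 <= k ->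
  exists a, [/\ a <= k, coprime a k & forall i, i < L -> ~~ prime (a + i * k)].
Proof.
move=> k1 Q0 zQ hM hQ hn hk.
have k0 : 0 < k by apply: ltnW.
have [c [c1 c2]] := greedy_residues k (iota 0 L) (primes_upto_uniq z) (@primes_upto_prime z).
rewrite size_iota in c2; set r := survivors k c (primes_upto z) (iota 0 L) in c2.
have rM : size r <= M.
  rewrite leqNgt; apply/negP => h.
  have := leq_trans (leq_mul h (leqnn _)) c2.
  by rewrite leqNgt hM.
set s := [seq p <- primes_upto Q | (z < p) && ~~ (p %| k)] in hQ.
have us : uniq s by rewrite filter_uniq // primes_upto_uniq.
have ps q : q \in s -> [/\ prime q, z < q, q <= Q & ~~ (q %| k)].
  by rewrite mem_filter mem_primes_upto => /andP[/andP[-> ->] /andP[-> ->]].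
pose P := \prod_(p <- primes_upto z) p.
have Pdvd p : p \in primes_upto z -> p %| P.
  by move=> hp; rewrite /P (big_rem p) //= dvdn_mulr.
have coP q : prime q -> z < q -> coprime P q.
  move=> pq zq; apply: coprime_prod_primes => //; first by move=> p /primes_upto_prime.
  by rewrite mem_primes_upto pq leqNgt zq.
have [c' hc' hr] := @assign_residues k r s P c (leq_trans rM hQ) us
  (fun q h => let: And4 h _ _ _ := ps q h in h)
  (fun q h => let: And4 h1 h2 _ _ := ps q h in coP q h1 h2).
pose u := take (size r) s.
have pu q : q \in u -> [/\ prime q, z < q, q <= Q & ~~ (q %| k)] by move=> /mem_take /ps.
pose m := P * \prod_(q <- u) q.
have mp : 0 < m.
  rewrite muln_gt0; apply/andP; split.
    rewrite /P big_seq; apply: prodn_cond_gt0 => p /primes_upto_prime; exact: prime_gt0.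
  by rewrite big_seq; apply: prodn_cond_gt0 => p /pu[/prime_gt0].
have mle : m <= P * Q ^ M.
  rewrite /m leq_mul2l; apply/orP; right.
  apply: leq_trans (_ : Q ^ size u <= _).
    by apply: prod_take_le => q /ps[].
  by rewrite leq_pexp2l // (leq_trans _ rM) // size_take; case: ltnP.
(* Starting the window at Q + 1 forces a > Q, so a term of the progression divisible by a prime q <=
   Q is not q itself. *)
have [t [t1 t2 ht]] : exists t, [/\ Q.+1 <= t, t < Q.+1 + n
    & forall p, p \in [seq p <- primes k | z < p] -> ~~ (p %| c' %% m + m * t)].
  apply: avoid_residues; last by rewrite big_filter.
  move=> p; rewrite mem_filter mem_primes => /andP[zp /and3P[pp _ pk]]; split=> //.
  rewrite /m coprimeMl coP //=; apply: coprime_prod_primes => //.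
    by move=> q /pu[].
  by apply/negP => /pu[_ _ _]; rewrite pk.
pose a := c' %% m + m * t.
have ac : a = c' %[mod m] by rewrite /a addnC mulnC modnMDl modn_mod.
exists a; split.
- apply: leq_trans hk; apply: leq_trans (_ : m * (Q + n).+1 <= _); last first.
    by rewrite leq_mul2r mle orbT.
  apply: leq_trans (_ : m * t.+1 <= _).
    by rewrite /a mulnSr addnC leq_add2l ltnW // ltn_mod.
  by rewrite leq_mul2l; apply/orP; right; rewrite -addSn.
- rewrite coprime_has_primes ?(ltnW k1) //; last first.
    by rewrite addn_gt0 muln_gt0 mp (leq_ltn_trans _ t1) ?orbT.
  apply/hasPn => p; rewrite !mem_primes => /and3P[pp _ pk].
  rewrite pp /= negb_and; apply/orP; right.
  case: (leqP p z) => pz; last by apply: ht; rewrite mem_filter pz mem_primes pp k0.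
  have pz' : p \in primes_upto z by rewrite mem_primes_upto pp.
  have e : a = 1 %[mod p].
    rewrite (cong_dvd (dvdn_trans (Pdvd p pz') (dvdn_mulr _ (dvdnn P))) ac).
    by rewrite (cong_dvd (Pdvd p pz') hc') c1.
  by rewrite /dvdn e modn_small ?prime_gt1.
move=> i iL.
have [q q1 q2] : exists2 q, q <= Q /\ prime q & q %| a + i * k.
  (* A survivor is divisible by its own prime in (z, Q]; any other index was eliminated by a prime
     up to z. *)
  case: (boolP (i \in r)) => ir.
    have [q qu qd] := hr i ir; have [h1 h2 h3 h4] := pu q qu.
    exists q => //; rewrite (dvdn_add_mul_cong i k (cong_dvd _ ac)) //.
    by apply: dvdn_mull; rewrite (big_rem q) //= dvdn_mulr.
  move: ir; rewrite mem_filter mem_iota /= iL andbT => /allPn[q qz].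
  rewrite negb_or negbK => /andP[qk qd]; exists q.
    by split; [exact: leq_trans (primes_upto_le qz) zQ | exact: primes_upto_prime qz].
  rewrite (dvdn_add_mul_cong i k (c' := c)) //.
  rewrite (cong_dvd (dvdn_trans (Pdvd q qz) (dvdn_mulr _ (dvdnn P))) ac).
  exact: cong_dvd (Pdvd q qz) hc'.
have aQ : Q < a.
  apply: leq_trans t1 _; apply: leq_trans (leq_addl _ _).
  by rewrite leq_pmull.
case: q1 => qQ pq; apply/negP => pa; move: q2; rewrite dvdn_prime2 // => /eqP e.
by move: (leq_trans aQ (leq_addr (i * k) a)); rewrite -e ltnNge qQ.
Qed.

(** * P-integers and prime divisors *)

(** At most [size (primes k)] primes up to N divide k, so at least phi(k) of them are coprime to k
    and the whole list s lies below N. Being a reduced residue system, s meets the class of a, and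
    its member there is a + i k with i <= N / k. *)
Lemma P_integer_class k a L N : P_integer k -> a <= k -> coprime a k ->
  N %/ k < L -> totient k + size (primes k) <= size (primes_upto N) ->
  exists2 i, i < L & prime (a + i * k).
Proof.
move=> [k1 [s [[ss szs sp sall] [_ sco suq]]]] ak ca NL hN.
have k0 : 0 < k by apply: ltnW.
have us : uniq s by apply: sorted_uniq ss; [apply: ltn_trans | apply: ltnn].
pose t := [seq p <- primes_upto N | coprime p k].
have ht : totient k <= size t.
  rewrite -(leq_add2r (size (primes k))); apply: leq_trans hN _.
  rewrite -(count_predC (fun p => coprime p k)) size_filter leq_add2l.
  rewrite -size_filter; apply: uniq_leq_size; first by rewrite filter_uniq ?primes_upto_uniq.
  move=> p; rewrite mem_filter /= => /andP[h /primes_upto_prime pp]; rewrite mem_primes pp k0 /=.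
  by move: h; rewrite prime_coprime // negbK.
have sN q : q \in s -> q <= N.
  move=> qs; rewrite leqNgt; apply/negP => Nq.
  have : size (q :: t) <= size s.
    apply: uniq_leq_size.
      rewrite /= filter_uniq ?primes_upto_uniq // andbT mem_filter mem_primes_upto negb_and negb_and.
      by rewrite -ltnNge Nq !orbT.
    move=> p; rewrite inE => /orP[/eqP->//|]; rewrite mem_filter mem_primes_upto => /andP[cp /andP[pp pN]].
    by apply: (sall p q) => //; apply: leq_ltn_trans Nq.
  by rewrite /= szs ltnNge ht.
(* The residues of s are distinct, coprime to k and phi(k) in number, so they exhaust the reduced
   classes. *)
have amem : a %% k \in [seq p %% k | p <- s].
  have [||_ ->] := @uniq_min_size _ [seq p %% k | p <- s] [seq i <- iota 0 k | coprime i k] suq.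
  - move=> _ /mapP[p /sco cp ->]; rewrite mem_filter mem_iota /= ltn_mod k0 andbT.
    by rewrite coprime_modl.
  - rewrite size_map szs totient_count_coprime size_filter -sum1_count big_mkcond /=.
    by rewrite /index_iota subn0; apply: leq_sum => i _; rewrite coprime_sym; case: coprime.
  by rewrite mem_filter mem_iota /= ltn_mod k0 andbT coprime_modl.
case/mapP: amem => p ps e.
have [pp _] := sp p ps.
have ap : a <= p.
  rewrite leqNgt; apply/negP => pa.
  have pk : p < k by apply: leq_trans pa ak.
  rewrite (modn_small pk) in e; move: ak; rewrite leq_eqVlt => /orP[/eqP ak|ak].
    by rewrite ak modnn in e; rewrite -e in pp.
  by rewrite (modn_small ak) in e; rewrite e ltnn in pa.
have /dvdnP[i ei] : k %| p - a by rewrite -eqn_mod_dvd // e.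
exists i; last by rewrite -ei subnKC.
apply: leq_ltn_trans NL; rewrite leq_divRL // -ei.
by apply: leq_trans (sN p ps); rewrite leq_subr.
Qed.

(** * The Euler product for the totient *)

Lemma one_sub_inv p : prime p -> (0 < 1 - 1 / INR p < 1)%R.
Proof.
move=> /INR_prime_ge2 h.
have : (1 / INR p <= 1 / 2)%R by apply/Rle_div_l; lra.
have : (0 < 1 / INR p)%R by apply: Rdiv_lt_0_compat; lra.
by lra.
Qed.

Lemma rprod_le1 (s : seq nat) : (forall p, p \in s -> prime p) ->
  (0 < \rprod_(p <- s) (1 - 1 / INR p) <= 1)%R.
Proof.
move=> hs; split; first by apply: rprod_gt0 => p /hs /one_sub_inv; lra.
elim: s hs => [|p s IH] hs; first by rewrite big_nil; lra.
have h1 : (0 < \rprod_(p <- s) (1 - 1 / INR p))%R.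
  by apply: rprod_gt0 => q hq; have /one_sub_inv : prime q by [apply: hs; rewrite inE hq orbT]; lra.
have h2 : (\rprod_(p <- s) (1 - 1 / INR p) <= 1)%R.
  by apply: IH => q hq; apply: hs; rewrite inE hq orbT.
have /one_sub_inv : prime p by apply: hs; rewrite inE eqxx.
by rewrite big_cons; nra.
Qed.

Lemma totient_real k : 0 < k ->
  INR (totient k) = (INR k * \rprod_(p <- primes k) (1 - 1 / INR p))%R.
Proof.
move=> k0; rewrite totientE // {3}(prod_primes k0) !INR_prod -big_split /=.
apply: eq_big_seq => p hp.
move: (hp); rewrite mem_primes => /and3P[pp _ _].
have e : (0 < logn p k) by rewrite logn_gt0.
have p2 := INR_prime_ge2 pp.
rewrite -[in X in _ = X](prednK e) expnS !INRM INR_pred_prime //.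
set y := INR (p ^ _); by field; lra.
Qed.

(** In the Euler product of phi(k)/k the primes up to z are kept exactly, those in (z, Q] are each
    replaced by the larger factor 1 - 1/Q, and those above Q are dropped. *)
Lemma totient_le k z Q : 0 < k -> z <= Q -> 0 < Q ->
  (INR (totient k) <= INR k * (\rprod_(p <- [seq p <- primes_upto z | p %| k]) (1 - 1 / INR p)
     * (1 - 1 / INR Q) ^ size [seq p <- primes_upto Q | (z < p)%N && (p %| k)]))%R.
Proof.
move=> k0 zQ Q0; rewrite totient_real //; apply: Rmult_le_compat_l; first exact: pos_INR.
set s1 := [seq p <- primes_upto z | p %| k]; set s2 := [seq p <- primes_upto Q | (z < p) && (p %| k)].
have pk p : p \in primes k -> prime p by rewrite mem_primes => /and3P[].
have m1 p : (p \in s1) = (p %| k) && (prime p && (p <= z)) by rewrite mem_filter mem_primes_upto.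
have m2 p : (p \in s2) = ((z < p) && (p %| k)) && (prime p && (p <= Q)).
  by rewrite mem_filter mem_primes_upto.
have e12 : perm_eq [seq p <- primes k | p <= Q] (s1 ++ s2).
  apply: uniq_perm; first by rewrite filter_uniq // primes_uniq.
    rewrite cat_uniq (filter_uniq _ (primes_upto_uniq z)) (filter_uniq _ (primes_upto_uniq Q)) andbT andTb; apply/hasPn => p.
    by rewrite m2 => /andP[/andP[zp _] _]; rewrite /= m1 [p <= z]leqNgt zp !andbF.
  move=> p; rewrite mem_cat m1 m2 mem_filter mem_primes k0 /=.
  case: (prime p); rewrite ?andbF //=; case: (p %| k); rewrite ?andbF ?andbT //=.
  by case: (leqP p z) => //= pz; rewrite (leq_trans pz zQ).
rewrite (bigID (fun p => p <= Q)) /= -big_filter -[X in (_ * X)%R]big_filter.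
rewrite (perm_big _ e12) big_cat /=.
have h1 : (0 < \rprod_(p <- s1) (1 - 1 / INR p) <= 1)%R.
  by apply: rprod_le1 => p; rewrite mem_filter => /andP[_ /primes_upto_prime].
have h3 : (0 < \rprod_(p <- [seq p <- primes k | ~~ (p <= Q)%N]) (1 - 1 / INR p) <= 1)%R.
  by apply: rprod_le1 => p; rewrite mem_filter => /andP[_ /pk].
have h2 : (0 <= \rprod_(p <- s2) (1 - 1 / INR p) <= (1 - 1 / INR Q) ^ size s2)%R.
  have -> : ((1 - 1 / INR Q) ^ size s2 = \rprod_(p <- s2) (1 - 1 / INR Q))%R.
    by elim: (s2) => [|p s IH]; rewrite ?big_nil ?big_cons //= IH.
  apply: rprod_le => p; rewrite mem_filter => /andP[_ hp].
  have /one_sub_inv h := primes_upto_prime hp; split; first by lra.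
  have p0 := INR_gt0 (prime_gt0 (primes_upto_prime hp)).
  have := leINR (primes_upto_le hp) => pQ.
  have : (/ INR Q <= / INR p)%R by apply: Rinv_le_contravar.
  by rewrite /Rdiv; lra.
apply: Rle_trans (_ : (_ <= \rprod_(p <- s1) (1 - 1 / INR p) * \rprod_(p <- s2) (1 - 1 / INR p) * 1)%R) _.
  by apply: Rmult_le_compat_l; [apply: Rmult_le_pos; lra | lra].
by rewrite Rmult_1_r; apply: Rmult_le_compat_l; lra.
Qed.

(** * Number and reciprocals of the prime divisors of k *)

(** Comparison with one sixth of the integral of 1/x: entries at least 6 apart have the largest
    reciprocal sum when packed as y + 6, y + 12, and so on. *)
Lemma gap6_sum (s : seq nat) y : path (fun a b => a + 6 <= b) y s -> 0 < y ->
  (\rsum_(p <- s) (1 / INR p) <= (ln (INR y + 6 * INR (size s)) - ln (INR y)) / 6)%R.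
Proof.
elim: s y => [|p s IH] y; first by rewrite big_nil /= Rmult_0_r Rplus_0_r; lra.
cbn [path] => /andP[yp /IH h] y0.
have y1 := INR_gt0 y0.
have p6 := leINR yp; rewrite INRD (_ : INR 6 = 6)%R in p6; last by rewrite /=; lra.
have {}h := h (leq_trans y0 (leq_trans (leq_addr 6 y) yp)).
rewrite big_cons (_ : size (p :: s) = (size s).+1) // S_INR.
set n := INR (size s) in h *; have n0 : (0 <= n)%R by apply: pos_INR.
set P := INR p in p6 h *; set Y := INR y in p6 y1 *.
have a1 : (1 / P <= (ln (Y + 6) - ln Y) / 6)%R.
  have := @ln_tangent (Y + 6) Y ltac:(lra) y1.
  have -> : (Y / (Y + 6) - 1 = - (6 / (Y + 6)))%R by field; lra.
  have : (1 / P <= 1 / (Y + 6))%R by apply: Rmult_le_compat_l; [lra | apply: Rinv_le_contravar; lra].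
  by rewrite (_ : 6 / (Y + 6) = 6 * (1 / (Y + 6)))%R; [lra | field; lra].
have a2 : (ln (P + 6 * n) - ln P <= ln (Y + 6 + 6 * n) - ln (Y + 6))%R.
  rewrite -!ln_div; try lra.
  apply: ln_le; first by apply: Rdiv_lt_0_compat; lra.
  have -> : ((P + 6 * n) / P = 1 + 6 * n / P)%R by field; lra.
  have -> : ((Y + 6 + 6 * n) / (Y + 6) = 1 + 6 * n / (Y + 6))%R by field; lra.
  apply: Rplus_le_compat_l; apply: Rmult_le_compat_l; [lra | apply: Rinv_le_contravar; lra].
have -> : (Y + 6 * (n + 1) = Y + 6 + 6 * n)%R by lra.
by lra.
Qed.

Lemma same_residue_gap6 (s : seq nat) z r : sorted ltn s -> 5 <= z ->
  (forall p, p \in s -> z < p /\ p %% 6 = r) -> path (fun a b => a + 6 <= b) (z - 5) s.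
Proof.
case: s => [//|p s] hs z5 h.
have e : z - 5 + 6 = z.+1 by rewrite addnS subnK.
cbn [path]; apply/andP; split.
  by rewrite e; have [] := h p (mem_head _ _).
apply: (@sub_in_path _ (fun a => a %% 6 == r) ltn) (hs : path ltn p s).
  move=> a b; rewrite !unfold_in => /eqP ha /eqP hb ab.
  have : 6 %| b - a by rewrite -(eqn_mod_dvd _ (ltnW ab)) ha hb.
  by move=> /dvdn_leq; rewrite subn_gt0 => /(_ ab); rewrite (leq_subRL _ (ltnW ab)).
by apply/allP => a ha; have [_ e6] := h a ha; apply/eqP.
Qed.

Lemma prime_mod6 p : prime p -> 6 < p -> (p %% 6 == 1) = ~~ (p %% 6 == 5).
Proof.
move=> pp p6.
have nd q : prime q -> q < 6 -> p %% q != 0.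
  move=> pq q6; apply/negP => h; move: (h : q %| p).
  by rewrite dvdn_prime2 // => /eqP e; rewrite e ltnNge ltnW in q6.
have h2 := nd 2 isT isT; have h3 := nd 3 isT isT.
rewrite -(@modn_dvdm 6 p 2) // in h2; rewrite -(@modn_dvdm 6 p 3) // in h3.
have := ltn_pmod p (isT : 0 < 6).
by move: (p %% 6) h2 h3 => [|[|[|[|[|[|n]]]]]].
Qed.

(** The union bound needs a value below 1. Primes above z fall into the classes 1 and 5 modulo 6;
    with Y = z - 5 and a, b members, the arithmetic-geometric mean inequality bounds (Y + 6a)(Y +
    6b) by (18 Y)^2, and the sum by (ln 18) / 3. *)
Lemma sum_inv_primes_le k z : 6 <= z ->
  (INR (size [seq p <- primes k | (z < p)%N]) <= 5.6 * INR (z - 5))%R ->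
  (\rsum_(p <- [seq p <- primes k | (z < p)%N]) (1 / INR p) <= 0.9641)%R.
Proof.
move=> z6.
have z5 : 5 <= z by apply: ltnW.
set D := [seq p <- primes k | z < p] => hw.
have mD p : p \in D -> prime p /\ z < p.
  by rewrite mem_filter mem_primes => /andP[-> /and3P[-> _ _]].
have sD : sorted ltn D by apply: sorted_filter; [apply: ltn_trans | apply: sorted_primes].
pose D1 := [seq p <- D | p %% 6 == 1]; pose D5 := [seq p <- D | p %% 6 == 5].
have eD : \rsum_(p <- D) (1 / INR p) = (\rsum_(p <- D1) (1 / INR p) + \rsum_(p <- D5) (1 / INR p))%R.
  rewrite (bigID (fun p => p %% 6 == 1)) /= -big_filter; congr (_ + _)%R.
  rewrite -big_filter; congr bigop; apply: eq_in_filter => p /mD[pp zp].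
  by rewrite prime_mod6 ?negbK // (leq_ltn_trans z6).
have sz : size D = size D1 + size D5.
  rewrite -(count_predC (fun p => p %% 6 == 1) D) [size D1]size_filter [size D5]size_filter.
  congr (_ + _).
  apply: eq_in_count => p /mD[pp zp] /=.
  by rewrite prime_mod6 ?negbK // (leq_ltn_trans z6).
have y0 : 0 < z - 5 by rewrite subn_gt0.
have g r : path (fun a b => a + 6 <= b) (z - 5) [seq p <- D | p %% 6 == r].
  apply: (@same_residue_gap6 _ _ r) => //; first by apply: sorted_filter => //; apply: ltn_trans.
  by move=> p; rewrite mem_filter => /andP[/eqP-> /mD[]].
have h1 := gap6_sum (g 1) y0; have h5 := gap6_sum (g 5) y0.
rewrite -/D1 in h1; rewrite -/D5 in h5.
have Y0 := INR_gt0 y0.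
rewrite sz INRD in hw; rewrite eD.
have n1 := pos_INR (size D1); have n5 := pos_INR (size D5).
set Y := INR (z - 5) in Y0 hw h1 h5; set a := INR (size D1) in hw n1 h1; set b := INR (size D5) in hw n5 h5.
have hln : (ln (Y + 6 * a) + ln (Y + 6 * b) <= 2 * (ln 18 + ln Y))%R.
  rewrite -ln_mult; try lra.
  have -> : (2 * (ln 18 + ln Y) = ln ((18 * Y) * (18 * Y)))%R by rewrite !ln_mult; lra.
  have uv : (Y + 6 * a + (Y + 6 * b) <= 36 * Y)%R by lra.
  have := Rmult_le_compat _ _ _ _ (_ : 0 <= Y + 6 * a + (Y + 6 * b))%R (_ : 0 <= Y + 6 * a + (Y + 6 * b))%R uv uv.
  move=> /(_ ltac:(lra) ltac:(lra)) sq; have := pow2_ge_0 (6 * a - 6 * b) => sq2.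
  by apply: ln_le; [apply: Rmult_lt_0_compat; lra | lra].
have : (ln 18 = ln 2 + 2 * ln 3)%R.
  by rewrite (_ : 18 = 2 * (3 * 3))%R ?ln_mult; lra.
by have := ln2_bounds; have := ln3_bounds; lra.
Qed.

Lemma INR_sum (s : seq nat) (f : nat -> nat) :
  INR (\sum_(i <- s) f i) = \rsum_(i <- s) INR (f i).
Proof.
elim: s => [|a s IH]; first by rewrite !big_nil.
by rewrite !big_cons INRD IH.
Qed.

Lemma count_prime_divisors_le k b (s : seq nat) : 0 < k -> 0 < b -> uniq s ->
  (forall p, p \in s -> [/\ prime p, p %| k & b <= p]) ->
  (INR (size s) * ln (INR b) <= ln (INR k))%R.
Proof.
move=> k0 b0 us hs.
rewrite -ln_INR_exp //; apply: ln_le; first by apply: INR_gt0; rewrite expn_gt0 b0.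
apply: leINR; apply: leq_trans (_ : \prod_(p <- s) p <= _).
  elim: s hs {us} => [|p s IH] hs; first by rewrite big_nil.
  rewrite big_cons /= expnS leq_mul //; first by have [] := hs p (mem_head _ _).
  by apply: IH => q hq; apply: hs; rewrite inE hq orbT.
by apply: dvdn_leq => //; apply: prod_primes_dvd => // p /hs[].
Qed.

Lemma count_large_prime_divisors k z : 0 < k -> 0 < z ->
  (INR (size [seq p <- primes k | (z < p)%N]) * ln (INR z) <= ln (INR k))%R.
Proof.
move=> k0 z0; apply: count_prime_divisors_le => //; first by rewrite filter_uniq // primes_uniq.
by move=> p; rewrite mem_filter mem_primes => /andP[zp /and3P[-> _ ->]]; rewrite ltnW.
Qed.

Lemma count_primes_window k z Q : z <= Q ->
  size (primes_upto Q) = size (primes_upto z) + size [seq p <- primes_upto Q | (z < p) && (p %| k)]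
                + size [seq p <- primes_upto Q | (z < p) && ~~ (p %| k)].
Proof.
move=> zQ; rewrite {1}(primes_upto_split zQ) size_cat -addnA; congr (_ + _).
rewrite -(count_predC (fun p => p %| k) [seq p <- primes_upto Q | z < p]) -!size_filter.
by congr (_ + _); rewrite -filter_predI; congr size; apply: eq_filter => p /=; rewrite andbC.
Qed.

(** * From a P-integer to numerical inequalities *)

Lemma exp_ge_sq (x : R) : (8000 <= x)%R -> (250000 * (x * x) <= exp x)%R.
Proof.
move=> hx; have h := exp_ineq1_le (x / 4).
have e : (exp x = (exp (x / 4) * exp (x / 4)) * (exp (x / 4) * exp (x / 4)))%R.
  by rewrite -!exp_plus; congr exp; lra.
have h2 : ((x / 4) * (x / 4) <= exp (x / 4) * exp (x / 4))%R.
  by apply: Rmult_le_compat; lra.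
have h0 : (0 <= (x / 4) * (x / 4))%R by apply: Rmult_le_pos; lra.
have h4 := Rmult_le_compat _ _ _ _ h0 h0 h2 h2.
rewrite e; apply: Rle_trans h4.
have xx : (64000000 <= x * x)%R.
  by have := Rmult_le_compat 8000 x 8000 x ltac:(lra) ltac:(lra) hx hx; lra.
have := Rmult_le_compat_r (x * x) _ _ ltac:(lra) xx.
by lra.
Qed.

Lemma ln_8000 : (8.984 <= ln 8000 <= 8.993)%R.
Proof.
have -> : (ln 8000 = 6 * ln 2 + 3 * ln 5)%R.
  rewrite (_ : 8000 = 2 ^ 6 * 5 ^ 3)%R; last by lra.
  by rewrite ln_mult ?ln_pow /=; lra.
by have := ln2_bounds; have := ln5_bounds; lra.
Qed.

Lemma pow_1m_le_exp (Q W0 : R) (n : nat) : (1 <= Q)%R -> (W0 <= INR n)%R ->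
  ((1 - 1 / Q) ^ n <= exp (- W0 / Q))%R.
Proof.
move=> hQ hW.
have q0 : (0 < / Q <= 1)%R.
  split; first by apply: Rinv_0_lt_compat; lra.
  by rewrite -Rinv_1; apply: Rinv_le_contravar; lra.
apply: Rle_trans (_ : (exp (- / Q) ^ n <= _)%R).
  by apply: pow_incr; rewrite /Rdiv; have := exp_ineq1_le (Ropp (/ Q)); lra.
have -> : (exp (- / Q) ^ n = exp (INR n * (- / Q)))%R.
  elim: n {hW} => [|n IH]; first by rewrite /= Rmult_0_l exp_0.
  by rewrite S_INR Rmult_plus_distr_r Rmult_1_l exp_plus -IH /= Rmult_comm.
apply: exp_le_mono; rewrite /Rdiv.
by have := Rmult_le_compat_r (/ Q) _ _ ltac:(lra) hW; lra.
Qed.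

(** V bounds the Euler product up to z, W0 is a lower bound for the number of prime divisors of k in
    (z, Q], and M bounds the number of survivors. The last two hypotheses ask for enough primes in
    (z, Q] and for a modulus below k; 0.0017 ln k pays for the factor Q + n + 1. *)
Lemma P_integer_contradiction k z Q (V th W0 M : R) :
  P_integer k ->
  (8000 <= ln (INR k))%R -> 1000 <= z -> z <= Q -> (INR Q <= 3 * ln (INR k))%R ->
  (ln (INR k) <= 5.6 * (INR z - 5) * ln (INR z))%R ->
  (\rsum_(p <- primes_upto z) ln (INR p) <= th)%R ->
  (\rprod_(p <- primes_upto z) (1 - 1 / INR p) <= V)%R ->
  (W0 <= INR (size [seq p <- primes_upto Q | (z < p)%N && (p %| k)]))%R ->
  (V * exp (- W0 / INR Q) * (1.0013 * ln (INR k)) / 0.921 + 2 <= M)%R ->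
  (INR (size (primes_upto z)) + INR (size [seq p <- primes_upto Q | (z < p)%N && (p %| k)]) + M
     <= INR (size (primes_upto Q)))%R ->
  (th + M * ln (INR Q) + 0.0017 * ln (INR k) <= ln (INR k))%R ->
  False.
Proof.
move=> Pk; set x := ln (INR k) => x8 z1 zQ Q3 xz hth hV hW hM hcount hcost.
have k1 : 1 < k by case: Pk.
have k0 : 0 < k by apply: ltnW.
have K0 := INR_gt0 k0.
have Q0 : 0 < Q by apply: leq_trans zQ; apply: leq_trans z1.
have q1 : (1 <= INR Q)%R by have := leINR Q0.
have hk : (250000 * (x * x) <= INR k)%R.
  by rewrite -[INR k]exp_ln // -/x; apply: exp_ge_sq.
have lx : (ln x <= x / 8000 + 7.993)%R.
  by have := @ln_tangent 8000 x ltac:(lra) ltac:(lra); have := ln_8000; lra.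
have lx1 : (8 <= ln x)%R by have := @ln_le 8000 x ltac:(lra) x8; have := ln_8000; lra.
(* Y = ln (e k x) will bound ln N, where N is of size about phi(k) x / 0.921. *)
pose Y := (x + ln x + 1)%R.
have Y1 : (x <= Y <= 1.0013 * x)%R by rewrite /Y; lra.
pose w := size [seq p <- primes k | z < p].
have hwx : (INR w * ln (INR z) <= x)%R by apply: count_large_prime_divisors => //; apply: leq_trans z1.
have Z1 : (1000 <= INR z)%R.
  by have := leINR z1; rewrite (_ : INR 1000 = 1000)%R // INR_IZR_INZ.
have lz : (6.8 <= ln (INR z))%R.
  have := @ln_le 1000 (INR z) ltac:(lra) Z1.
  have -> : (ln 1000 = 3 * ln 2 + 3 * ln 5)%R.
    rewrite (_ : 1000 = 2 ^ 3 * 5 ^ 3)%R; last by lra.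
    by rewrite ln_mult ?ln_pow /=; lra.
  by have := ln2_bounds; have := ln5_bounds; lra.
have w0 := pos_INR w.
have hw : (INR w <= 5.6 * (INR z - 5))%R.
  apply: (@Rmult_le_reg_r (ln (INR z))); lra.
have hw2 : (6.8 * INR w <= x)%R by nra.
have om : (INR (size (primes k)) * ln 2 <= x)%R.
  have := @count_prime_divisors_le k 2 (primes k) k0 isT (primes_uniq k).
  rewrite (_ : INR 2 = 2)%R //; apply=> p; rewrite mem_primes => /and3P[pp _ pk].
  by split=> //; apply: prime_gt1.
have om2 : (INR (size (primes k)) <= 1.5 * x)%R.
  by have := pos_INR (size (primes k)); have := ln2_bounds; nra.
set om' := INR (size (primes k)) in om om2.
have om0 : (0 <= om')%R by apply: pos_INR.
have hphi := totient_le k0 zQ Q0.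
set PRk := \rprod_(p <- [seq p <- primes_upto z | p %| k]) _ in hphi.
set PRW := ((1 - 1 / INR Q) ^ _)%R in hphi.
have PRW1 : (PRW <= exp (- W0 / INR Q))%R by apply: pow_1m_le_exp.
have PRk0 : (0 < PRk <= 1)%R.
  by apply: rprod_le1 => p; rewrite mem_filter => /andP[_ /primes_upto_prime].
pose PR1 := \rprod_(p <- [seq p <- primes_upto z | ~~ (p %| k)]) (1 - 1 / INR p).
have PR10 : (0 < PR1 <= 1)%R.
  by apply: rprod_le1 => p; rewrite mem_filter => /andP[_ /primes_upto_prime].
have PRV : (PRk * PR1 <= V)%R.
  apply: Rle_trans hV; rewrite [X in (_ <= X)%R](bigID (fun p => p %| k)) /=.
  by rewrite /PRk /PR1 !big_filter; apply: Rle_refl.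
have PRW0 : (0 <= PRW)%R.
  apply: pow_le; suff : (1 / INR Q <= 1)%R by lra.
  by apply/Rle_div_l; lra.
set f := INR (totient k) in hphi.
have f0 : (0 <= f)%R by apply: pos_INR.
have fk : (f <= INR k)%R.
  apply: Rle_trans hphi _; rewrite -[X in (_ <= X)%R]Rmult_1_r.
  apply: Rmult_le_compat_l; first by lra.
  have : (PRW <= 1)%R.
    rewrite -(pow1 (size [seq p <- primes_upto Q | (z < p)%N && (p %| k)])); apply: pow_incr.
    have : (0 < 1 / INR Q <= 1)%R by split; [apply: Rdiv_lt_0_compat; lra | apply/Rle_div_l; lra].
    by lra.
  by nra.
have xx : (8000 * x <= x * x)%R by apply: Rmult_le_compat_r; lra.
have r0 : (0 <= (f + om' + 3) * Y / 0.921 / 30)%R.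
  by apply: Rle_mult_inv_pos; [apply: Rle_mult_inv_pos; [apply: Rmult_le_pos; lra | lra] | lra].
have [j0 [hj1 hj2]] := nfloor_ex _ r0.
(* The next multiple of 30, the shape required by [pi_lower]. *)
pose N := 30 * j0.+1.
have N30 : INR N = (30 * (INR j0 + 1))%R by rewrite /N INRM (S_INR j0) (_ : INR 30 = 30)%R // INR_IZR_INZ.
have N1 : ((f + om' + 3) * Y / 0.921 <= INR N)%R by rewrite N30; lra.
have N2 : (INR N <= (f + om' + 3) * Y / 0.921 + 30)%R by rewrite N30; lra.
(* The terms of N not containing phi(k) amount to at most k / 2, hence 1/2 in N / k and 3/2 in L. *)
have small : ((om' + 3) * Y / 0.921 + 30 <= 0.5 * INR k)%R.
  suff : ((om' + 3) * Y <= (1.51 * x) * (1.0013 * x))%R by lra.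
  by apply: Rmult_le_compat; lra.
have fY : (f * Y <= INR k * (1.0013 * x))%R by apply: Rmult_le_compat; lra.
have lnN : (ln (INR N) <= Y)%R.
  rewrite -[Y]ln_exp; apply: ln_le; first by apply: INR_gt0; rewrite /N muln_gt0.
  have -> : exp Y = (INR k * x * exp 1)%R.
    by rewrite /Y !exp_plus exp_ln; [rewrite exp_ln //; lra | lra].
  have e2 := exp_ineq1_le 1.
  have kx : (8000 * INR k <= INR k * x)%R by have := Rmult_le_compat_l _ _ _ (Rlt_le _ _ K0) x8; lra.
  have := Rmult_le_compat_l (INR k * x) _ _ ltac:(lra) e2.
  by lra.
have piN : totient k + size (primes k) <= size (primes_upto N).
  apply: INR_leq; rewrite INRD -/f -/om'.
  have := pi_lower (ltn0Sn j0); rewrite -/N => h.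
  have pi0 := pos_INR (size (primes_upto N)).
  have h2 : ((INR (size (primes_upto N)) + 3) * ln (INR N) <= (INR (size (primes_upto N)) + 3) * Y)%R.
    by apply: Rmult_le_compat_l; lra.
  have h3 : ((f + om' + 3) * Y <= (INR (size (primes_upto N)) + 3) * Y)%R by lra.
  have := @Rmult_le_reg_r Y (f + om' + 3) (INR (size (primes_upto N)) + 3) ltac:(lra) h3.
  by lra.
pose L := (N %/ k).+1.
have hL : (INR L <= f / INR k * Y / 0.921 + 1.5)%R.
  have d : (INR (N %/ k) * INR k <= INR N)%R.
    by rewrite -INRM; apply: leINR; apply: leq_trunc_div.
  rewrite /L S_INR; suff : (INR (N %/ k) <= f / INR k * Y / 0.921 + 0.5)%R by lra.
  apply: (@Rmult_le_reg_r (INR k)) => //.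
  have -> : ((f / INR k * Y / 0.921 + 0.5) * INR k = f * Y / 0.921 + 0.5 * INR k)%R by field; lra.
  by lra.
(* phi(k)/k supplies the Euler factors of the primes up to z that divide k and PR1 those of the
   others; together they form the full product bounded by V. *)
have fkY : (f / INR k * PR1 <= V * exp (- W0 / INR Q))%R.
  have h1 : (f / INR k <= PRk * PRW)%R by apply/Rle_div_l => //; lra.
  apply: Rle_trans (_ : (_ <= (PRk * PRW) * PR1)%R) _; first by apply: Rmult_le_compat_r; lra.
  have -> : (PRk * PRW * PR1 = (PRk * PR1) * PRW)%R by ring.
  by apply: Rmult_le_compat; try lra; apply: Rmult_le_pos; lra.
have LM : (INR L * PR1 <= M - 0.5)%R.
  have h := Rmult_le_compat_r PR1 _ _ ltac:(lra) hL.
  have fkp : (0 <= f / INR k * PR1)%R.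
    by apply: Rmult_le_pos; [apply: Rle_mult_inv_pos; lra | lra].
  have h2 : (f / INR k * PR1 * Y <= V * exp (- W0 / INR Q) * (1.0013 * x))%R.
    by apply: Rmult_le_compat; lra.
  have e : ((f / INR k * Y / 0.921 + 1.5) * PR1 = f / INR k * PR1 * Y / 0.921 + 1.5 * PR1)%R by field; lra.
  by rewrite e in h; lra.
have M0p : (0 <= M)%R.
  have : (0 <= INR L * PR1)%R by apply: Rmult_le_pos; [apply: pos_INR | lra].
  by lra.
have [M0 [M1 M2]] := nfloor_ex _ M0p.
(* The window must satisfy 0.9641 n + w < n, and 30 * 0.0359 > 1. *)
pose n := 30 * w + 30.
have In : INR n = (30 * INR w + 30)%R by rewrite /n INRD INRM (_ : INR 30 = 30)%R // INR_IZR_INZ.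
have z6 : 6 <= z by apply: leq_trans z1.
have z5 : INR (z - 5) = (INR z - 5)%R.
  have i5 : INR 5 = 5%R by rewrite INR_IZR_INZ.
  by have := INRD (z - 5) 5; rewrite (subnK (ltnW z6)) i5 => ->; lra.
have [||||a [ak ca ha]] := @sieve_class k z Q L M0 n k1 Q0 zQ.
- apply: INR_ltn; rewrite !INRM -!(big_filter _ (fun p => ~~ (p %| k))) !INR_prod S_INR.
  set s := [seq p <- primes_upto z | ~~ (p %| k)].
  have ps p : p \in s -> prime p by rewrite mem_filter => /andP[_ /primes_upto_prime].
  have -> : \rprod_(p <- s) INR p.-1 = (PR1 * \rprod_(p <- s) INR p)%R.
    rewrite /PR1 -/s -big_split /=; apply: eq_big_seq => p /ps pp.
    by rewrite INR_pred_prime //; have := INR_prime_ge2 pp => h; field; lra.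
  rewrite -Rmult_assoc; apply: Rmult_lt_compat_r; last by lra.
  by apply: rprod_gt0 => p /ps /prime_gt0 /INR_gt0.
- apply: INR_leq; have := count_primes_window k zQ => e.
  by rewrite e !INRD in hcount; lra.
- rewrite -(big_filter _ (fun p => z < p)); apply: INR_ltn; rewrite INR_sum.
  have := @sum_inv_primes_le k z z6; rewrite z5 => /(_ hw) hS.
  set D := [seq p <- primes k | z < p] in hS *.
  pose S := \rsum_(p <- D) (1 / INR p); rewrite -/S in hS.
  apply: (@Rle_lt_trans _ (INR n * S + INR w * 1)).
    have -> : (INR n * S + INR w * 1)%R = \rsum_(p <- D) (INR n * (1 / INR p) + 1).
      by rewrite big_split rsum_scale rsum_const.
    apply: rsum_le => p.
    rewrite mem_filter mem_primes => /andP[_ /and3P[pp _ _]].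
    have p0 := INR_gt0 (prime_gt0 pp).
    rewrite INRD (_ : INR 1 = 1)%R //; apply: Rplus_le_compat_r.
    rewrite /Rdiv Rmult_1_l; apply/Rle_div_r => //.
    by rewrite -INRM; apply: leINR; apply: leq_trunc_div.
  have n0 : (0 <= INR n)%R by apply: pos_INR.
  have := Rmult_le_compat_l _ _ _ n0 hS.
  by rewrite In; lra.
- have P0 : 0 < \prod_(p <- primes_upto z) p.
    rewrite big_seq; apply: prodn_cond_gt0 => p /primes_upto_prime; exact: prime_gt0.
  apply: INR_leq; rewrite -[X in (_ <= X)%R]exp_ln // -/x.
  have QM0 : 0 < Q ^ M0 by rewrite expn_gt0 Q0.
  rewrite -[X in (X <= _)%R]exp_ln; last by apply: INR_gt0; rewrite !muln_gt0 P0 QM0.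
  apply: exp_le_mono; rewrite !INRM !ln_mult; try by [apply: INR_gt0 | apply: Rmult_lt_0_compat; apply: INR_gt0].
  rewrite ln_prod_primes_upto ln_INR_exp //.
  have lQ : (0 <= ln (INR Q))%R by apply: ln_ge0.
  have h1 := Rmult_le_compat_r _ _ _ lQ M1.
  (* Q is at most 3 x, and n is at most 30 x / 6.8 + 30 because w ln z <= x. *)
  have h2 : (ln (INR (Q + n).+1) <= ln (8 * x))%R.
    by apply: ln_le; [apply: INR_gt0 | rewrite S_INR INRD In; lra].
  have h3 : (ln (8 * x) = 3 * ln 2 + ln x)%R.
    rewrite (_ : 8 * x = 2 ^ 3 * x)%R; last by lra.
    by rewrite ln_mult ?ln_pow /=; lra.
  by have := ln2_bounds; lra.
have [i iL pi] := P_integer_class Pk ak ca (ltnSn _ : N %/ k < L) piN.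
by have := ha i iL; rewrite pi.
Qed.

(** * The range of ln k *)

Lemma count_window_divisors_le k z Q : 0 < k -> 0 < z ->
  (INR (size [seq p <- primes_upto Q | (z < p)%N && (p %| k)]) * ln (INR z) <= ln (INR k))%R.
Proof.
move=> k0 z0; apply: count_prime_divisors_le => //; first by rewrite filter_uniq // primes_upto_uniq.
by move=> p; rewrite mem_filter => /andP[/andP[zp ->] /primes_upto_prime ->]; rewrite ltnW.
Qed.

Lemma window_divisors_mono k z Q Q' : Q <= Q' ->
  (INR (size [seq p <- primes_upto Q | (z < p)%N && (p %| k)])
     <= INR (size [seq p <- primes_upto Q' | (z < p)%N && (p %| k)]))%R.
Proof.
move=> h; apply: leINR; rewrite (primes_upto_split h) filter_cat size_cat; exact: leq_addr.
Qed.

Lemma multiple_of_30 (r : R) : (30 <= r)%R ->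
  exists j, [/\ 0 < j, (r - 30 <= INR (30 * j))%R & (INR (30 * j) <= r)%R].
Proof.
move=> hr; have [j [h1 h2]] := nfloor_ex (r / 30) ltac:(lra).
have e : INR (30 * j) = (30 * INR j)%R by rewrite INRM (_ : INR 30 = 30)%R // INR_IZR_INZ.
exists j; rewrite e; split; try lra.
by apply: INR_ltn; rewrite /=; lra.
Qed.

(* [30 * j] is the upper end Q, about [q * ln k], of the range of the primes that
   kill one survivor each; [w * ln k] and [W1] bound the number of prime divisors
   of k between z and Q. *)
Lemma sieve_step k z j (c th V q w W1 F l : R) :
  P_integer k ->
  (8000 <= ln (INR k))%R -> 1000 <= z ->
  (ln (INR k) <= 5.6 * (INR z - 5) * ln (INR z))%R ->
  prime_data z c th V -> (0 <= V)%R ->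
  (INR z <= q * ln (INR k) - 30)%R -> (1 <= q <= 3)%R ->
  0 < j -> (q * ln (INR k) - 30 <= INR (30 * j))%R -> (INR (30 * j) <= q * ln (INR k))%R ->
  (0 <= w)%R ->
  (w * ln (INR k) <= INR (size [seq p <- primes_upto (30 * j) | (z < p)%N && (p %| k)]) <= W1)%R ->
  (1 <= F * (1 + w / q))%R ->
  (ln (q * ln (INR k)) <= l)%R ->
  ((c + W1 + (V * F * (1.0013 * ln (INR k)) / 0.921 + 2) + 3) * l
     <= 0.921 * (q * ln (INR k) - 30))%R ->
  (th + (V * F * (1.0013 * ln (INR k)) / 0.921 + 2) * l + 0.0017 * ln (INR k)
     <= ln (INR k))%R ->
  False.
Proof.
set x := ln (INR k) => Pk x8 z1 xz [hc hth hV] V0 zq q13 j0 Q1 Q2 w0 [hw1 hw2] hF hl hcount hcost.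
set Q := 30 * j in Q1 Q2 hw1 hw2.
set M := (V * F * (1.0013 * x) / 0.921 + 2)%R in hcount hcost.
have zQ : z <= Q by apply: INR_leq; lra.
have Z1 : (1000 <= INR z)%R.
  by have := leINR z1; rewrite (_ : INR 1000 = 1000)%R // INR_IZR_INZ.
have Qp : (0 < INR Q)%R by lra.
have lQ : (0 < ln (INR Q) <= l)%R.
  split; first by rewrite -ln_1; apply: ln_increasing; lra.
  by apply: Rle_trans hl; apply: ln_le.
have qx : (0 < q * x)%R by apply: Rmult_lt_0_compat; lra.
have wq : (0 <= w / q)%R by apply: Rle_mult_inv_pos; lra.
have F0 : (0 < F)%R by nra.
(* F replaces the exponential: as Q <= q x, it is at most exp (-w/q) <= 1 / (1 + w/q), so the
   condition on F is purely rational. *)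
have hE : (exp (- (w * x) / INR Q) <= F)%R.
  apply: Rle_trans (_ : (exp (- (w / q)) <= F)%R).
    apply: exp_le_mono.
    have h1 : (w / q * INR Q <= w / q * (q * x))%R by apply: Rmult_le_compat_l.
    have e1 : (w / q * (q * x) = w * x)%R by field; lra.
    rewrite e1 in h1; have h2 : (w / q <= w * x / INR Q)%R by apply/(Rle_div_r _ _ _ Qp).
    by rewrite /Rdiv in h2 *; lra.
  have := exp_ineq1_le (w / q) => h; rewrite exp_Ropp.
  have e0 := exp_pos (w / q).
  apply: (@Rmult_le_reg_r (exp (w / q))) => //; rewrite Rinv_l; last by lra.
  by apply: Rle_trans hF _; apply: Rmult_le_compat_l; lra.
have M0 : (0 <= M)%R.
  suff : (0 <= V * F * (1.0013 * x) / 0.921)%R by rewrite /M; lra.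
  apply: Rle_mult_inv_pos; last by lra.
  by apply: Rmult_le_pos; [apply: Rmult_le_pos; lra | lra].
apply: (@P_integer_contradiction k z Q V th (w * x)%R M Pk x8 z1 zQ) => //.
- by rewrite -/x; nra.
- rewrite -/x /M; apply: Rplus_le_compat_r; apply: Rmult_le_compat_r; first by lra.
  apply: Rmult_le_compat_r; first by lra.
  by apply: Rmult_le_compat_l.
- have := pi_lower j0; rewrite -/Q => hp.
  set W := INR (size [seq p <- primes_upto Q | _]) in hw1 hw2 *.
  have s0 := pos_INR (size (primes_upto Q)).
  have h1 : ((INR (size (primes_upto Q)) + 3) * ln (INR Q) <= (INR (size (primes_upto Q)) + 3) * l)%R.
    by apply: Rmult_le_compat_l; lra.
  have h2 : ((c + W1 + M + 3) * l <= (INR (size (primes_upto Q)) + 3) * l)%R by lra.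
  have := Rmult_le_reg_r _ _ _ (_ : 0 < l)%R h2 => /(_ ltac:(lra)).
  by lra.
- rewrite -/x; have := Rmult_le_compat_l _ _ _ M0 (proj2 lQ); lra.
Qed.

(** The square lies below its chord, which makes the quadratic conditions on a range of ln k
    accessible to linear arithmetic. *)
Lemma convex_window (lo hi x : R) : (lo <= x <= hi)%R -> (x * x <= (lo + hi) * x - lo * hi)%R.
Proof. by move=> [h1 h2]; have := Rmult_le_pos (x - lo) (hi - x) ltac:(lra) ltac:(lra); lra. Qed.

Lemma ln_prod235 a b c : (ln (2 ^ a * 3 ^ b * 5 ^ c) = INR a * ln 2 + INR b * ln 3 + INR c * ln 5)%R.
Proof.
have p2 : (0 < 2 ^ a)%R by apply: pow_lt; lra.
have p3 : (0 < 3 ^ b)%R by apply: pow_lt; lra.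
have p5 : (0 < 5 ^ c)%R by apply: pow_lt; lra.
by rewrite !ln_mult ?ln_pow //; try lra; apply: Rmult_lt_0_compat.
Qed.

(** The tangent is taken at a 5-smooth point y because numerical bounds are at hand for ln 2, ln 3
    and ln 5. *)
Lemma ln_tangent235 a b c (y x : R) : y = (2 ^ a * 3 ^ b * 5 ^ c)%R -> (0 < x)%R ->
  (ln x <= INR a * 0.69354 + INR b * 1.0993 + INR c * 1.6104 + (x / y - 1))%R.
Proof.
move=> ey x0; have y0 : (0 < y)%R.
  by rewrite ey; apply: Rmult_lt_0_compat; [apply: Rmult_lt_0_compat |]; apply: pow_lt; lra.
apply: Rle_trans (ln_tangent y0 x0) _; rewrite {1}ey ln_prod235.
have := Rmult_le_compat_l _ _ _ (pos_INR a) (proj2 ln2_bounds).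
have := Rmult_le_compat_l _ _ _ (pos_INR b) (proj2 ln3_bounds).
have := Rmult_le_compat_l _ _ _ (pos_INR c) (proj2 ln5_bounds).
by lra.
Qed.

Lemma ln_ge25 a c (y : R) : y = (2 ^ a * 3 ^ 0 * 5 ^ c)%R ->
  (INR a * 0.69295 + INR c * 1.609 <= ln y)%R.
Proof.
move=> ->; rewrite ln_prod235.
have := Rmult_le_compat_l _ _ _ (pos_INR a) (proj1 ln2_bounds).
have := Rmult_le_compat_l _ _ _ (pos_INR c) (proj1 ln5_bounds).
by rewrite /=; lra.
Qed.

(* Prime divisors of k between z and Q are unavailable for the sieve, which forces
   a larger Q, but many of them make phi(k)/k, and hence the number of survivors,
   smaller. *)
Lemma window_1000 k : P_integer k -> (8000 <= ln (INR k) <= 12000)%R -> False.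
Proof.
move=> Pk hx; have k0 : 0 < k by case: Pk => /ltnW.
set x := ln (INR k) in hx *.
have i1000 : INR 1000 = 1000%R by rewrite INR_IZR_INZ.
have lz : (6.9058 <= ln (INR 1000))%R.
  by rewrite i1000; have := @ln_ge25 3 3 1000 ltac:(lra); rewrite /=; lra.
have sq := convex_window hx.
have [j1 [j10 j11 j12]] := @multiple_of_30 (2 * x) ltac:(lra).
have [j2 [j20 j21 j22]] := @multiple_of_30 (2.8 * x) ltac:(lra).
have l1 : (ln (2 * x) <= 8.9093 + x / 10000)%R.
  by have := @ln_tangent235 5 0 4 20000 (2 * x) ltac:(lra) ltac:(lra); rewrite /=; lra.
have l2 : (ln (2.8 * x) <= 9.2098 + 2.8 * x / 27000)%R.
  by have := @ln_tangent235 3 3 3 27000 (2.8 * x) ltac:(lra) ltac:(lra); rewrite /=; lra.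
have xz : (x <= 5.6 * (INR 1000 - 5) * ln (INR 1000))%R by move: lz; rewrite i1000; lra.
(* If at most 0.075 x primes of the interval up to 2x are lost to k, then Q near 2x suffices, with w
   = 0 and F = 1. *)
case: (Rle_lt_dec (INR (size [seq p <- primes_upto (30 * j1) | (1000 < p)%N && (p %| k)])) (0.075 * x)) => hW.
  apply: (@sieve_step k 1000 j1 168 959 0.080966 2 0 (0.075 * x) 1 _
    Pk (proj1 hx) (leqnn _) xz prime_data_1000 _ _ _ j10 j11 j12 _ _ _ l1); rewrite -/x ?i1000; try lra.
  by split=> //; rewrite Rmult_0_l; apply: pos_INR.
have jj : 30 * j1 <= 30 * j2 by apply: INR_leq; lra.
(* Otherwise Q is near 2.8 x; up to x / ln 1000 primes may be lost, but w = 0.075 allows F = 0.974,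
   since 0.974 (1 + 0.075 / 2.8) > 1. *)
apply: (@sieve_step k 1000 j2 168 959 0.080966 2.8 0.075 (x / 6.9058) 0.974 _
    Pk (proj1 hx) (leqnn _) xz prime_data_1000 _ _ _ j20 j21 j22 _ _ _ l2); rewrite -/x ?i1000; try lra.
split; first by have := window_divisors_mono k 1000 jj; lra.
have := @count_window_divisors_le k 1000 (30 * j2) k0 isT; rewrite -/x.
set W := INR (size _) => h; have W0 : (0 <= W)%R by apply: pos_INR.
apply/Rle_div_r; [lra | nra].
Qed.

Lemma window_2000 k : P_integer k -> (12000 <= ln (INR k) <= 30000)%R -> False.
Proof.
move=> Pk hx; have k0 : 0 < k by case: Pk => /ltnW.
set x := ln (INR k) in hx *.
have x8 : (8000 <= x)%R by lra.
have i2000 : INR 2000 = 2000%R by rewrite INR_IZR_INZ.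
have lz : (7.5988 <= ln (INR 2000))%R.
  by rewrite i2000; have := @ln_ge25 4 3 2000 ltac:(lra); rewrite /=; lra.
have sq := convex_window hx.
have [j1 [j10 j11 j12]] := @multiple_of_30 (2 * x) ltac:(lra).
have [j2 [j20 j21 j22]] := @multiple_of_30 (2.8 * x) ltac:(lra).
have l1 : (ln (2 * x) <= 9.6029 + x / 20000)%R.
  by have := @ln_tangent235 6 0 4 40000 (2 * x) ltac:(lra) ltac:(lra); rewrite /=; lra.
have l2 : (ln (2.8 * x) <= 9.9033 + 2.8 * x / 54000)%R.
  by have := @ln_tangent235 4 3 3 54000 (2.8 * x) ltac:(lra) ltac:(lra); rewrite /=; lra.
have xz : (x <= 5.6 * (INR 2000 - 5) * ln (INR 2000))%R by move: lz; rewrite i2000; lra.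
case: (Rle_lt_dec (INR (size [seq p <- primes_upto (30 * j1) | (2000 < p)%N && (p %| k)])) (0.07 * x)) => hW.
  apply: (@sieve_step k 2000 j1 303 1945 0.073672 2 0 (0.07 * x) 1 _
    Pk x8 isT xz prime_data_2000 _ _ _ j10 j11 j12 _ _ _ l1); rewrite -/x ?i2000; try lra.
  by split=> //; rewrite Rmult_0_l; apply: pos_INR.
have jj : 30 * j1 <= 30 * j2 by apply: INR_leq; lra.
apply: (@sieve_step k 2000 j2 303 1945 0.073672 2.8 0.07 (x / 7.5988) 0.9757 _
    Pk x8 isT xz prime_data_2000 _ _ _ j20 j21 j22 _ _ _ l2); rewrite -/x ?i2000; try lra.
split; first by have := window_divisors_mono k 2000 jj; lra.
have := @count_window_divisors_le k 2000 (30 * j2) k0 isT; rewrite -/x.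
set W := INR (size _) => h; have W0 : (0 <= W)%R by apply: pos_INR.
by apply/Rle_div_r; [lra | nra].
Qed.

(** From here on Q near 3x leaves enough primes even when k has as many prime divisors above z as
    its size permits, x / ln z, so no case distinction is made. *)
Lemma window_4000 k : P_integer k -> (30000 <= ln (INR k) <= 100000)%R -> False.
Proof.
move=> Pk hx; have k0 : 0 < k by case: Pk => /ltnW.
set x := ln (INR k) in hx *.
have x8 : (8000 <= x)%R by lra.
have i4000 : INR 4000 = 4000%R by rewrite INR_IZR_INZ.
have lz : (8.2917 <= ln (INR 4000))%R.
  by rewrite i4000; have := @ln_ge25 5 3 4000 ltac:(lra); rewrite /=; lra.
have sq := convex_window hx.
have [j [j0 j1 j2]] := @multiple_of_30 (3 * x) ltac:(lra).
have l1 : (ln (3 * x) <= 11.0026 + 3 * x / 162000)%R.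
  by have := @ln_tangent235 4 4 3 162000 (3 * x) ltac:(lra) ltac:(lra); rewrite /=; lra.
have xz : (x <= 5.6 * (INR 4000 - 5) * ln (INR 4000))%R by move: lz; rewrite i4000; lra.
apply: (@sieve_step k 4000 j 550 3920 0.067591 3 0 (x / 8.2917) 1 _
    Pk x8 isT xz prime_data_4000 _ _ _ j0 j1 j2 _ _ _ l1); rewrite -/x ?i4000; try lra.
have := @count_window_divisors_le k 4000 (30 * j) k0 isT; rewrite -/x.
set W := INR (size _) => h; have W0 : (0 <= W)%R by apply: pos_INR.
by split; [lra | apply/Rle_div_r; [lra | nra]].
Qed.

Lemma window_8000 k : P_integer k -> (100000 <= ln (INR k) <= 400000)%R -> False.
Proof.
move=> Pk hx; have k0 : 0 < k by case: Pk => /ltnW.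
set x := ln (INR k) in hx *.
have x8 : (8000 <= x)%R by lra.
have lz : (8.984 <= ln (INR 8000))%R by rewrite INR_8000; have := ln_8000; lra.
have sq := convex_window hx.
have [j [j0 j1 j2]] := @multiple_of_30 (3 * x) ltac:(lra).
have l1 : (ln (3 * x) <= 12.3897 + 3 * x / 648000)%R.
  by have := @ln_tangent235 6 4 3 648000 (3 * x) ltac:(lra) ltac:(lra); rewrite /=; lra.
have xz : (x <= 5.6 * (INR 8000 - 5) * ln (INR 8000))%R by move: lz; rewrite INR_8000; lra.
apply: (@sieve_step k 8000 j 1007 7891 0.062412 3 0 (x / 8.984) 1 _
    Pk x8 isT xz prime_data_8000 _ _ _ j0 j1 j2 _ _ _ l1); rewrite -/x ?INR_8000; try lra.
have := @count_window_divisors_le k 8000 (30 * j) k0 isT; rewrite -/x.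
set W := INR (size _) => h; have W0 : (0 <= W)%R by apply: pos_INR.
by split; [lra | apply/Rle_div_r; [lra | nra]].
Qed.

(** At most y primes are up to y, and each of the others contributes at least ln y. It is applied
    with y near the square root of z. *)
Lemma pi_le_theta y z : 0 < y ->
  ((INR (size (primes_upto z)) - INR y) * ln (INR y) <= \rsum_(p <- primes_upto z) ln (INR p))%R.
Proof.
move=> y0; have ly := ln_ge0 y0.
pose s := [seq p <- primes_upto z | y < p].
have sz : (INR (size (primes_upto z)) - INR y <= INR (size s))%R.
  suff : size (primes_upto z) <= y + size s by move=> /leINR; rewrite INRD; lra.
  rewrite -(count_predC (fun p => y < p)) addnC /s size_filter leq_add2r.
  rewrite -size_filter -[X in _ <= X](size_iota 1 y); apply: uniq_leq_size.
    exact: (filter_uniq _ (primes_upto_uniq z)).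
  move=> p; rewrite mem_filter mem_primes_upto mem_iota /= -leqNgt add1n ltnS.
  by move=> /andP[-> /andP[/prime_gt0 -> _]].
apply: Rle_trans (_ : (_ <= INR (size s) * ln (INR y))%R) _; first by apply: Rmult_le_compat_r.
rewrite -rsum_const; apply: Rle_trans (_ : (_ <= \rsum_(p <- s) ln (INR p))%R) _.
  apply: rsum_le => p; rewrite mem_filter => /andP[yp _].
  by apply: ln_le; [apply: INR_gt0 | apply: leINR; apply: ltnW].
apply: rsum_subseq; [exact: (filter_uniq _ (primes_upto_uniq z)) | exact: primes_upto_uniq | |].
  by move=> p; rewrite mem_filter => /andP[].
by move=> p /primes_upto_prime /prime_gt0 /ln_ge0.
Qed.

Lemma window_infinite k : P_integer k -> (400000 <= ln (INR k))%R -> False.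
Proof.
move=> Pk hx; have k0 : 0 < k by case: Pk => /ltnW.
set x := ln (INR k) in hx *.
have x8 : (8000 <= x)%R by lra.
have [z [z1 z2]] := nfloor_ex (x / 16) ltac:(lra).
have Z8 : (24999 <= INR z)%R by lra.
have z8 : 8000 <= z by apply: INR_leq; rewrite INR_8000; lra.
have z0 : 0 < z by apply: leq_trans z8.
pose t := ln (x / 16).
have t1 : (10.1238 <= t)%R.
  have := @ln_ge25 3 5 25000 ltac:(lra).
  have := @ln_le 25000 (x / 16) ltac:(lra) ltac:(lra).
  by rewrite -/t /=; lra.
have lS : (t <= ln (INR z.+1))%R by apply: ln_le; [lra | rewrite S_INR; lra].
have lz : (t - 0.0001 <= ln (INR z))%R.
  have := @ln_tangent (INR z) (INR z.+1) ltac:(lra) ltac:(rewrite S_INR; lra).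
  have : (INR z.+1 / INR z <= 1.0001)%R by apply/Rle_div_l; rewrite ?S_INR; lra.
  by lra.
have l1 : (ln (3 * x) <= t + 3.8735)%R.
  have -> : (3 * x = 48 * (x / 16))%R by lra.
  rewrite ln_mult; try lra.
  have -> : (48 = 2 ^ 4 * 3 ^ 1 * 5 ^ 0)%R by lra.
  by rewrite ln_prod235 -/t /=; have := ln2_bounds; have := ln3_bounds; lra.
pose V := (0.594 / t)%R.
have V0 : (0 <= V)%R by apply: Rle_mult_inv_pos; lra.
have hV : (\rprod_(p <- primes_upto z) (1 - 1 / INR p) <= V)%R.
  apply: Rle_trans (euler_prod_le z8) _.
  by apply: Rmult_le_compat_l; [lra | apply: Rinv_le_contravar; lra].
have hth : (\rsum_(p <- primes_upto z) ln (INR p) <= 0.0867 * x)%R.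
  by have := theta_le z; have := ln2_bounds; nra.
pose s := sqrt x.
have s2 : (s * s = x)%R by apply: sqrt_sqrt; lra.
have s0 : (0 <= s)%R by apply: sqrt_pos.
have s632 : (632 <= s)%R by nra.
(* As z is about x/16, y is about the square root of z, so ln (y + 1) is at least half of ln z. *)
have [y [y1 y2]] := nfloor_ex (s / 4) ltac:(lra).
have yz : (ln (INR z) / 2 <= ln (INR y.+1))%R.
  have : (ln (INR z) <= ln (INR y.+1 * INR y.+1))%R.
    by apply: ln_le; [lra | rewrite S_INR; nra].
  by rewrite ln_mult; rewrite ?S_INR; lra.
(* The scale of all counts: the primes up to z, the prime divisors of k above z and the survivors
   are constant multiples of r, up to terms of order s. *)
pose r := (x / t)%R.
have rt : (r * t = x)%R by rewrite /r; field; lra.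
have r0 : (0 <= r)%R by apply: Rle_mult_inv_pos; lra.
have rx : (10.1238 * r <= x)%R by nra.
have hc : (INR (size (primes_upto z)) <= s / 4 + 1 + 0.17351 * r)%R.
  have := pi_le_theta z (ltn0Sn y); rewrite [X in (_ - X)%R]S_INR => h.
  case: (Rle_lt_dec (INR (size (primes_upto z))) (INR y + 1)) => hp; first by lra.
  have h1 : ((INR (size (primes_upto z)) - (INR y + 1)) * ((t - 0.0001) / 2) <= 0.0867 * x)%R.
    apply: Rle_trans hth; apply: Rle_trans h; apply: Rmult_le_compat_l; lra.
  have h2 : ((INR (size (primes_upto z)) - (INR y + 1)) <= 0.17351 * r)%R.
    apply: (@Rmult_le_reg_r ((t - 0.0001) / 2)); [lra | nra].
  by lra.
have l2 : (t <= 0.005 * s + 7.22)%R.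
  have := @ln_tangent235 2 0 2 100 (s / 4) ltac:(lra) ltac:(lra).
  have -> : t = (2 * ln (s / 4))%R.
    rewrite /t (_ : x / 16 = s / 4 * (s / 4))%R; last by lra.
    by rewrite ln_mult; lra.
  by rewrite /=; lra.
have sx : (632 * s <= x)%R by nra.
(* Since l is t + 3.8735, r l equals x + 3.8735 r, and r is at most x / 10.1238. *)
have rl : (r * (t + 3.8735) <= 1.38262 * x)%R by lra.
have sl : ((s / 4 + 6) * (t + 3.8735) <= 0.0061 * x)%R.
  apply: Rle_trans (_ : (_ <= (s / 4 + 6) * (0.005 * s + 11.1))%R) _; last by lra.
  by apply: Rmult_le_compat_l; lra.
have eM : (V * 1 * (1.0013 * x) / 0.921 = 0.594 * 1.0013 / 0.921 * r)%R.
  by rewrite /V /r; field; lra.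
have [j [j0 j1 j2]] := @multiple_of_30 (3 * x) ltac:(lra).
have xz : (x <= 5.6 * (INR z - 5) * ln (INR z))%R.
  apply: Rle_trans (_ : (_ <= 5.6 * (INR z - 5) * 10)%R) _; first by lra.
  by apply: Rmult_le_compat_l; lra.
have zd : prime_data z (s / 4 + 1 + 0.17351 * r) (0.0867 * x) V by split.
apply: (@sieve_step k z j _ _ V 3 0 (1.00002 * r) 1 _
    Pk x8 (leq_trans _ z8) xz zd V0 _ _ j0 j1 j2 _ _ _ l1); rewrite -/x ?eM //; try lra.
have := @count_window_divisors_le k z (30 * j) k0 z0; rewrite -/x.
set W := INR (size _) => h; have W0 : (0 <= W)%R by apply: pos_INR.
split; first by lra.
apply: (@Rmult_le_reg_r (t - 0.0001)); first by lra.
apply: Rle_trans (_ : (_ <= W * ln (INR z))%R) _; first by apply: Rmult_le_compat_l; lra.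
by nra.
Qed.

Theorem theorem1p1 (k : nat) (hk : P_integer k) : k < 10 ^ 3500.
Proof.
rewrite ltnNge; apply/negP => kge.
have x8 : (8000 <= ln (INR k))%R.
  apply: Rle_trans (_ : (ln (INR (10 ^ 3500)) <= _)%R); last first.
    by apply: ln_le; [apply: INR_gt0; rewrite expn_gt0 | apply: leINR].
  rewrite ln_INR_exp // (_ : INR 10 = 10)%R; last by rewrite INR_IZR_INZ.
  rewrite (_ : INR 3500 = 3500)%R; last by rewrite INR_IZR_INZ.
  (* 3500 ln 10 is at least 3500 * 2.30195, about 8056. *)
  by have := @ln_ge25 1 1 10 ltac:(lra); rewrite /=; lra.
case: (Rle_lt_dec (ln (INR k)) 12000) => h1; first exact: (window_1000 hk).
case: (Rle_lt_dec (ln (INR k)) 30000) => h2; first by apply: (window_2000 hk); lra.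
case: (Rle_lt_dec (ln (INR k)) 100000) => h3; first by apply: (window_4000 hk); lra.
case: (Rle_lt_dec (ln (INR k)) 400000) => h4; first by apply: (window_8000 hk); lra.
by apply: (window_infinite hk); lra.
Qed.
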